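(* Let $1<p<\infty$ and let $X$ be a Banach lattice that, for every positive integer $k$ with $2k\le p$, does not contain any vector sublattice order-isomorphic to $\ell_{2k}$. If $X$ is $UH^p$-smooth, then $X$ has the $UDS_p$-property.
   Context: Banach lattices are real. $X$ contains a vector sublattice order-isomorphic to $\ell_r$ if there is a linear lattice homomorphism $T:\ell_r\to X$ that is an isomorphism (linear homeomorphism) onto its image, where $\ell_r$ has its coordinatewise order. Smoothness: let $1<p<\infty$ and let $N$ be the greatest integer strictly less than $p$. A function $\phi:X\to\mathbb R$ on a Banach space $X$ is $UH^p$-smooth if it is $N$ times Fréchet differentiable and there is $C>0$ with $\|\phi^{(N)}(x)-\phi^{(N)}(y)\|\le C\|x-y\|^{p-N}$ for all $x,y\in X$. The space $X$ is $UH^p$-smooth if there is a $UH^p$-smooth function on $X$ with bounded nonempty support. A sequence $\{x_k\}_{k=1}^\infty$ in a Banach space has an upper $p$-estimate with constant $C>0$ if $\|\sum_{k=1}^n a_kx_k\|\le C(\sum_{k=1}^n|a_k|^p)^{1/p}$ for all $n\in\mathbb N$ and $a_1,\dots,a_n\in\mathbb R$. A Banach lattice $X$ has the $UDS_p$-property if there is a constant $C>0$ such that every normalized disjoint sequence in $X$ (norm-one, pairwise disjoint vectors) has a subsequence with an upper $p$-estimate with constant $C$. *)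

(* Defs.v *)
From HB Require Import structures.
From mathcomp Require Import all_boot all_order all_algebra.
From mathcomp Require finmap.
From mathcomp Require Import all_classical all_reals all_analysis.

Set Implicit Arguments.
Unset Strict Implicit.
Unset Printing Implicit Defensive.

Import Order.TTheory GRing.Theory Num.Theory numFieldNormedType.Exports.
Local Open Scope classical_set_scope.
Local Open Scope ring_scope.

(* The order is data of the mixin: a type that is both an Order.POrder and a
   NormedModule has no compatible join with Num.NumDomain in the hierarchy. *)
HB.mixin Record isBanachLattice (R : realType) V & CompleteNormedModule R V := {
  vle : rel V ;
  vsup : V -> V -> V ;
  vinf : V -> V -> V ;
  vle_refl : reflexive vle ;
  vle_anti : antisymmetric vle ;
  vle_trans : transitive vle ;
  vsup_le : forall x y z : V, vle (vsup x y) z = vle x z && vle y z ;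
  vle_inf : forall x y z : V, vle z (vinf x y) = vle z x && vle z y ;
  vleD2r : forall x y z : V, vle x y -> vle (x + z) (y + z) ;
  vleZ : forall (a : R) (x y : V), 0 <= a -> vle x y -> vle (a *: x) (a *: y) ;
  vle_norm : forall x y : V,
    vle (vsup x (- x)) (vsup y (- y)) -> `|x| <= `|y|
}.

#[short(type="banachLatticeType")]
HB.structure Definition BanachLattice (R : realType) :=
  {V of CompleteNormedModule R V & isBanachLattice R V}.

Section BanachLatticeDefs.
Context {R : realType} {X : banachLatticeType R}.

(* The modulus in the lattice sense; `|x| is the norm. *)
Definition vabs (x : X) : X := vsup x (- x).

Definition vdisjoint (x y : X) : Prop := vinf (vabs x) (vabs y) = 0.

End BanachLatticeDefs.

(* The space L(V, W) of continuous linear operators, with the operator norm. *)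
Section ContinuousLinear.
Context {R : realType} (V W : normedModType R).

Definition clin : {pred V -> W} := mem [set f | linear f /\ continuous f].

Record contLin := ContLin { clin_fun :> V -> W; clinP : clin_fun \in clin }.

HB.instance Definition _ := [isSub for clin_fun].
HB.instance Definition _ := gen_eqMixin contLin.
HB.instance Definition _ := gen_choiceMixin contLin.

Lemma clin_submod_closed : submod_closed clin.
Proof.
split=> [|a f g]; rewrite !inE.
  by split=> [b u v|]; [rewrite /= scaler0 addr0 | exact: cst_continuous].
move=> [fl fc] [gl gc]; split=> [b u v|x].
  rewrite !fctE fl gl !scalerDr !scalerA (mulrC a b) -!addrA; congr (_ + _).
  by rewrite addrCA.
by apply: continuousD; [apply: continuousZr; exact: fc | exact: gc].
Qed.

HB.instance Definition _ :=
  GRing.isSubmodClosed.Build _ _ clin clin_submod_closed.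
HB.instance Definition _ := [SubChoice_isSubLmodule of contLin by <:].

Lemma clin_linear (f : contLin) : linear f.
Proof. by have := clinP f; rewrite inE => -[]. Qed.

Lemma clin_continuous (f : contLin) : continuous f.
Proof. by have := clinP f; rewrite inE => -[]. Qed.

HB.instance Definition _ (f : contLin) :=
  GRing.isLinear.Build R V W *:%R (clin_fun f) (@clin_linear f).

Definition opnorm (f : contLin) : R :=
  sup [set `|f x| | x in [set x : V | `|x| <= 1]].

Lemma opnorm_has_sup (f : contLin) :
  has_sup [set `|f x| | x in [set x : V | `|x| <= 1]].
Proof.
split; first by exists `|f 0|, 0 => //=; rewrite normr0.
have /linear_bounded_continuous/bounded_funP/(_ 1)[M fM] := @clin_continuous f.
by exists M => _ [x /= x1 <-]; exact: fM.
Qed.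

Lemma opnorm_ub (f : contLin) x : `|x| <= 1 -> `|f x| <= opnorm f.
Proof. by move=> x1; apply: ub_le_sup; [case: (opnorm_has_sup f) | exists x]. Qed.

Lemma opnorm_le (f : contLin) M :
  (forall x, `|x| <= 1 -> `|f x| <= M) -> opnorm f <= M.
Proof.
move=> fM; apply: ge_sup; first by case: (opnorm_has_sup f).
by move=> _ [x /= x1 <-]; exact: fM.
Qed.

Lemma opnormP (f : contLin) x : `|f x| <= opnorm f * `|x|.
Proof.
have [->|x0] := eqVneq x 0; first by rewrite linear0 !normr0 mulr0.
have nx : 0 < `|x| by rewrite normr_gt0.
rewrite -ler_pdivrMr//.
have /(opnorm_ub f) : `| `|x|^-1 *: x| <= 1.
  by rewrite normrZ ger0_norm ?invr_ge0// mulVf ?gt_eqF.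
by rewrite linearZ/= normrZ ger0_norm ?invr_ge0// mulrC.
Qed.

Lemma opnormD (f g : contLin) : opnorm (f + g) <= opnorm f + opnorm g.
Proof.
apply: opnorm_le => x x1; apply: le_trans (ler_normD _ _) _.
by apply: lerD; exact: opnorm_ub.
Qed.

Lemma opnormZ_le (a : R) (f : contLin) : opnorm (a *: f) <= `|a| * opnorm f.
Proof.
apply: opnorm_le => x x1; rewrite [X in `|X|](_ : _ = a *: f x)//.
by rewrite normrZ ler_wpM2l//; exact: opnorm_ub.
Qed.

Lemma opnormZ (a : R) (f : contLin) : opnorm (a *: f) = `|a| * opnorm f.
Proof.
apply/eqP; rewrite eq_le opnormZ_le/=.
have [->|a0] := eqVneq a 0.
  rewrite normr0 mul0r; apply: le_trans (opnorm_ub _ (x := 0) _) => //.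
  by rewrite normr0.
rewrite -ler_pdivlMl ?normr_gt0// -normfV.
by apply: le_trans (opnormZ_le _ _); rewrite scalerA mulVf// scale1r.
Qed.

Lemma opnorm0_eq0 (f : contLin) : opnorm f = 0 -> f = 0.
Proof.
move=> f0; apply/val_inj/funext => x /=.
by apply/normr0_eq0/eqP; rewrite eq_le normr_ge0 andbT (le_trans (opnormP _ _))//
  f0 mul0r.
Qed.

HB.instance Definition _ :=
  Lmodule_isNormed.Build R contLin opnormD opnormZ opnorm0_eq0.

Lemma clin_normE (f : contLin) :
  `|f| = sup [set `|f x| | x in [set x : V | `|x| <= 1]].
Proof. by []. Qed.

End ContinuousLinear.

Section HigherFrechet.
Context {R : realType} (V : normedModType R).

(* The Frechet derivative as a map V -> L(V, W); 'd f x is continuous whenever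
   f is differentiable at x, and the default value 0 is then not used. *)
Definition frechet (W : normedModType R) (f : V -> W) (x : V) : contLin V W :=
  insubd 0 ('d f x : V -> W).

Lemma frechetE (W : normedModType R) (f : V -> W) (x : V) :
  differentiable f x -> frechet f x = 'd f x :> (V -> W).
Proof.
move=> fx; rewrite /frechet insubdK// inE; split; last exact: diff_continuous.
by move=> a u v; rewrite linearP.
Qed.

(* L(V, L(V, ... L(V, W))), with n copies of V. *)
Fixpoint iterLin (n : nat) (W : normedModType R) : normedModType R :=
  if n is m.+1 then iterLin m (contLin V W) else W.

Fixpoint nfrechet (n : nat) : forall W : normedModType R,
    (V -> W) -> V -> iterLin n W :=
  match n with
  | 0 => fun W f => f
  | m.+1 => fun W f => nfrechet m (frechet f)
  end.

Fixpoint nfrechet_differentiable (n : nat) : forall W : normedModType R,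
    (V -> W) -> Prop :=
  match n with
  | 0 => fun W f => True
  | m.+1 => fun W f => (forall x, differentiable f x) /\
                       nfrechet_differentiable m (frechet f)
  end.

End HigherFrechet.

(* The greatest integer strictly less than p, when 1 < p. *)
Definition smooth_order {R : realType} (p : R) : nat := `|Num.ceil p - 1|%N.

Lemma smooth_orderP {R : realType} (p : R) : 1 < p ->
  forall n : nat, (n%:R < p) = (n <= smooth_order p)%N.
Proof.
move=> p1 n; rewrite -[n%:R]/((n%:Z)%:~R) -ceil_gt_int.
have c1 : 1 < Num.ceil p by rewrite ceil_gt_int.
by rewrite -lez_nat /smooth_order gez0_abs ?subr_ge0 ?(ltW c1)// lerBrDr lezD1.
Qed.

Section UHpSmooth.
Context {R : realType} (p : R) (X : normedModType R).

Definition UHp_smooth (phi : X -> R) : Prop :=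
  let N := smooth_order p in
  nfrechet_differentiable N phi /\
  exists2 C : R, 0 < C &
    forall x y,
      `|nfrechet N phi x - nfrechet N phi y| <= C * `|x - y| `^ (p - N%:R).

Definition supp (phi : X -> R) : set X := closure [set x | phi x != 0].

Definition UHp_smooth_space : Prop :=
  exists phi : X -> R,
    [/\ UHp_smooth phi, bounded_set (supp phi) & supp phi !=set0].

End UHpSmooth.

(* The space l_r, 1 <= r, of r-summable real sequences; counting measure has no
   nonempty null set, so LfunType needs no quotient. *)
Section Ell.
Context {R : realType} (r : R) (r1 : (1 <= r%:E)%E).

Definition ell := LfunType (@counting nat R) r1.

HB.instance Definition _ := GRing.Lmodule.on ell.

Definition ellnorm (a : ell) : R := fine ('N[@counting nat R]_(r%:E)[EFin \o a])%E.

Lemma ellnormD (a b : ell) : ellnorm (a + b) <= ellnorm a + ellnorm b.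
Proof. exact: ler_LnormD. Qed.

Lemma ellnormZ (l : R) (a : ell) : ellnorm (l *: a) = `|l| * ellnorm a.
Proof.
apply/EFin_inj; rewrite EFinM !finite_norm_fine.
exact: LnormZ.
Qed.

Lemma ellnorm0_eq0 (a : ell) : ellnorm a = 0 -> a = 0.
Proof.
move=> /fine_Lnormr_eq0[A [mA A0 sA]]; apply/LfuneqP => n; apply: contrapT => an.
have An : A n by apply: (sA n) => /= /(_ I).
have : (A `<=` set0)%classic.
  have [fA|fA] := pselect (finite_set A); last first.
    by move: A0; rewrite /= /counting asboolF.
  move: A0; rewrite /= /counting asboolT// => /eqP.
  by rewrite eqe pnatr_eq0 finmap.cardfs_eq0 => /eqP /fset_set_set0 ->.
by move/(_ _ An).
Qed.

HB.instance Definition _ :=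
  Lmodule_isNormed.Build R ell ellnormD ellnormZ ellnorm0_eq0.

Lemma ell_normE (a : ell) :
  (`|a|%:E = (\sum_(0 <= n <oo) (`|a n| `^ r)%:E) `^ r^-1)%E.
Proof.
have r0 : 0 < r by rewrite (lt_le_trans ltr01)// -lee_fin.
by rewrite [`|a|]/(ellnorm a) finite_norm_fine Lnorm_counting.
Qed.

Lemma ell_abs_ex (a : ell) : exists b : ell, forall n, b n = `|a n|.
Proof.
have aL : (a : nat -> R) \in Lfun (@counting nat R) r%:E by exact: LfunP.
suff fL : (fun n => `|a n|) \in Lfun (@counting nat R) r%:E.
  by exists (Lfun_Sub r1 fL).
move: aL => /andP[/[!inE] /= ma na]; apply/andP; split; rewrite inE/=.
  exact: measurableT_comp.
rewrite /finite_norm; under eq_Lnorm do rewrite /= -abse_EFin.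
by rewrite Lnorm_abse.
Qed.

Lemma ell_max_ex (a b : ell) :
  exists c : ell, forall n, c n = Num.max (a n) (b n).
Proof.
have [c cE] := ell_abs_ex (a - b); exists (2^-1 *: (a + b + c)) => n.
by rewrite maxr_absE mulrC -[in RHS]/((a - b) n) -cE.
Qed.

Lemma ell_min_ex (a b : ell) :
  exists c : ell, forall n, c n = Num.min (a n) (b n).
Proof.
have [c cE] := ell_abs_ex (a - b); exists (2^-1 *: (a + b - c)) => n.
by rewrite minr_absE mulrC -[in RHS]/((a - b) n) -cE.
Qed.

End Ell.

Section ContainsEll.
Context {R : realType}.

(* c is the coordinatewise supremum (infimum) of a and b; see ell_max_ex and
   ell_min_ex for the existence of such a c in l_r. *)
Definition ell_lattice_hom (r : R) (r1 : (1 <= r%:E)%E)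
    (X : banachLatticeType R) (T : ell r1 -> X) : Prop :=
  forall a b c : ell r1,
    ((forall n, c n = Num.max (a n) (b n)) -> T c = vsup (T a) (T b)) /\
    ((forall n, c n = Num.min (a n) (b n)) -> T c = vinf (T a) (T b)).

(* S is the inverse of T on the image of T, continuous for the topology induced
   by X on that image. *)
Definition contains_ell (r : R) (X : banachLatticeType R) : Prop :=
  exists (r1 : (1 <= r%:E)%E) (T : {linear ell r1 -> X}),
    [/\ ell_lattice_hom T, continuous T &
        exists2 S : X -> ell r1, cancel T S & {within range T, continuous S}].

End ContainsEll.

Section UDS.
Context {R : realType} (p : R) (X : banachLatticeType R).

(* Sequences are indexed from 0. *)
Definition upper_estimate (C : R) (x : nat -> X) : Prop :=
  forall (n : nat) (a : nat -> R),
    `|\sum_(k < n) a k *: x k| <= C * (\sum_(k < n) `|a k| `^ p) `^ p^-1.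

Definition normalized_disjoint (x : nat -> X) : Prop :=
  (forall k, `|x k| = 1) /\ (forall k l, k != l -> vdisjoint (x k) (x l)).

Definition UDS : Prop :=
  exists2 C : R, 0 < C &
    forall x : nat -> X, normalized_disjoint x ->
      exists2 s : nat -> nat, {homo s : k l / (k < l)%N} &
        upper_estimate C (x \o s).

End UDS.

(* Main.v *)
(* Let f be a smooth bump function and (x_n) a normalized disjoint sequence.  By
   Taylor's formula the even average (f(y+tx)+f(y-tx))/2 - f(y) is the sum of the
   even terms t^j D_x^j f(y)/j! with j < p, up to O(|t|^p).
   If D_{x_n}^j f(y) -> 0 for every y and every such even j > 0, then along a
   subsequence these terms are summably small, uniformly on the cubes spanned by
   the previous vectors.  Choosing signs greedily, f(y + sum +-a_k x_k) stays
   positive as long as sum |a_k|^p is small, which bounds the norm of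
   sum +-a_k x_k; disjoint sequences being unconditional, this is the upper
   p-estimate.
   Otherwise let m be the least even order that fails to vanish, at y say.
   Stopping the Taylor expansion at order m, the same greedy argument gives an
   upper m-estimate; near y, where D_{x_n}^m f is bounded away from 0, it also
   gives a lower m-estimate since f is bounded.  Hence (|x_n|) spans a sublattice
   isomorphic to l_m, which is excluded. *)
Require Import Defs.
From HB Require Import structures.
From mathcomp Require Import all_boot all_order all_algebra.
From mathcomp Require Import all_classical all_reals all_analysis.
From mathcomp Require Import ring lra.

Set Implicit Arguments.
Unset Strict Implicit.
Unset Printing Implicit Defensive.

Import Order.TTheory GRing.Theory Num.Theory numFieldNormedType.Exports.
Local Open Scope classical_set_scope.
Local Open Scope ring_scope.

(** * Vector lattice identities, disjointness and monotonicity of the norm *)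

Section VectorLattice.
Context {R : realType} {X : banachLatticeType R}.
Implicit Types (x y z u v w : X) (a b : R).

Lemma vle_supl x y : vle x (vsup x y).
Proof. by have := vsup_le x y (vsup x y); rewrite vle_refl => /esym/andP[]. Qed.

Lemma vle_supr x y : vle y (vsup x y).
Proof. by have := vsup_le x y (vsup x y); rewrite vle_refl => /esym/andP[]. Qed.

Lemma vinf_lel x y : vle (vinf x y) x.
Proof. by have := vle_inf x y (vinf x y); rewrite vle_refl => /esym/andP[]. Qed.

Lemma vinf_ler x y : vle (vinf x y) y.
Proof. by have := vle_inf x y (vinf x y); rewrite vle_refl => /esym/andP[]. Qed.

Lemma vle_eq x y : vle x y -> vle y x -> x = y.
Proof. by move=> xy yx; apply: vle_anti; rewrite xy yx. Qed.

Lemma vle_chain x y z : vle x y -> vle y z -> vle x z.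
Proof. exact: vle_trans. Qed.

Lemma vleD x y z w : vle x y -> vle z w -> vle (x + z) (y + w).
Proof.
move=> xy zw; apply: (@vle_chain _ (y + z)); first exact: vleD2r.
by rewrite ![y + _]addrC; exact: vleD2r.
Qed.

Lemma vle_subr x y z : vle x (y - z) = vle (x + z) y.
Proof.
apply/idP/idP => [/vleD2r-/(_ z)|/vleD2r-/(_ (- z))]; first by rewrite subrK.
by rewrite addrK.
Qed.

Lemma vle_subl x y z : vle (x - z) y = vle x (y + z).
Proof. by rewrite -{1}[y](addrK z) vle_subr subrK. Qed.

Lemma vleN x y : vle (- x) (- y) = vle y x.
Proof. by rewrite -[- x]add0r vle_subl addrC vle_subr add0r. Qed.

Lemma vsupC x y : vsup x y = vsup y x.
Proof. by apply: vle_eq; rewrite vsup_le vle_supl vle_supr. Qed.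

Lemma vsupD x y z : vsup x y + z = vsup (x + z) (y + z).
Proof.
apply: vle_eq; last by rewrite vsup_le !vleD2r ?vle_supl ?vle_supr.
by rewrite -vle_subr vsup_le !vle_subr vle_supl vle_supr.
Qed.

Lemma vinfC x y : vinf x y = vinf y x.
Proof. by apply: vle_eq; rewrite vle_inf vinf_lel vinf_ler. Qed.

Lemma vinfN x y : vinf x y = - vsup (- x) (- y).
Proof.
apply: vle_eq; last first.
  by rewrite vle_inf -(vleN x) -(vleN y) !opprK vle_supl vle_supr.
by rewrite -vleN opprK vsup_le !vleN vinf_lel vinf_ler.
Qed.

Lemma vsup_inf x y : vsup x y + vinf x y = x + y.
Proof.
rewrite vinfN; apply/eqP; rewrite subr_eq; apply/eqP.
by rewrite [RHS]addrC vsupD addrA addNr add0r addrCA addNr addr0 vsupC.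
Qed.

Lemma vsupZ a x y : 0 <= a -> a *: vsup x y = vsup (a *: x) (a *: y).
Proof.
rewrite le_eqVlt => /predU1P[<-|a0].
  by rewrite !scale0r; apply: vle_eq; rewrite ?vle_supl// vsup_le vle_refl.
apply: vle_eq; last by rewrite vsup_le !vleZ ?vle_supl ?vle_supr// ltW.
rewrite -[X in vle _ X](scale1r) -(divff (lt0r_neq0 a0)) -scalerA.
apply: vleZ; first exact: ltW.
have K z : z = a^-1 *: (a *: z) by rewrite scalerA mulVf ?lt0r_neq0// scale1r.
have ai : 0 <= a^-1 by rewrite invr_ge0 ltW.
by rewrite vsup_le; apply/andP; split; [rewrite {1}(K x)|rewrite {1}(K y)];
  apply: vleZ; rewrite ?vle_supl ?vle_supr.
Qed.

Lemma vhalf x : 2^-1 *: (x + x) = x.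
Proof.
have -> : x + x = (2 : R) *: x by rewrite scaler_nat mulr2n.
by rewrite scalerA mulVf ?scale1r// pnatr_eq0.
Qed.

Lemma vle_abs x : vle x (vabs x).
Proof. exact: vle_supl. Qed.

Lemma vabsN x : vabs (- x) = vabs x.
Proof. by rewrite /vabs opprK vsupC. Qed.

Lemma vabs_ge0 x : vle 0 (vabs x).
Proof.
rewrite -[0](scaler0 _ 2^-1) -[X in vle _ X]vhalf; apply: vleZ.
  by rewrite invr_ge0.
by rewrite -(addrN x); apply: vleD; rewrite ?vle_supl ?vle_supr.
Qed.

Lemma vabs_le x y : vle (vabs x) y = vle x y && vle (- x) y.
Proof. exact: vsup_le. Qed.

Lemma vabs_pos x : vle 0 x -> vabs x = x.
Proof.
move=> x0; apply: vle_eq; last exact: vle_abs.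
by rewrite vabs_le vle_refl/= (@vle_chain _ 0)// -oppr0 vleN.
Qed.

Lemma vabs_id x : vabs (vabs x) = vabs x.
Proof. exact/vabs_pos/vabs_ge0. Qed.

Lemma vabsZ a x : vabs (a *: x) = `|a| *: vabs x.
Proof.
have P b y : 0 <= b -> vabs (b *: y) = b *: vabs y.
  by move=> b0; rewrite /vabs vsupZ// scalerN.
have [a0|a0] := leP 0 a; first by rewrite P// ger0_norm.
by rewrite -vabsN -scaleNr P ?ltr0_norm// oppr_ge0 ltW.
Qed.

Lemma vabsD x y : vle (vabs (x + y)) (vabs x + vabs y).
Proof. by rewrite vabs_le opprD !vleD ?vle_supl ?vle_supr. Qed.

Lemma vabsB x y : vle (vabs (vabs x - vabs y)) (vabs (x - y)).
Proof.
have P u v : vle (vabs u - vabs v) (vabs (u - v)).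
  by rewrite vle_subl -{1}[u](subrK v) vabsD.
by rewrite vabs_le P opprB -(vabsN (x - y)) opprB P.
Qed.

(** Reduces the lattice operations to linear ones and the modulus, so a linear map that preserves
    moduli is a lattice homomorphism. *)
Lemma vsup_abs x y : vsup x y = 2^-1 *: (x + y + vabs (x - y)).
Proof.
have -> : x + y + vabs (x - y) = vsup (x + x) (y + y).
  rewrite /vabs [x + y + _]addrC vsupD opprB; congr vsup.
    by rewrite addrACA addNr addr0.
  by rewrite [x + y]addrC addrACA addNr addr0.
by rewrite vsupZ ?invr_ge0// !vhalf.
Qed.

Lemma vinf_abs x y : vinf x y = 2^-1 *: (x + y - vabs (x - y)).
Proof.
apply: (addrI (vsup x y)); rewrite vsup_inf vsup_abs -scalerDr.
by rewrite addrACA addrN addr0 vhalf.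
Qed.

Lemma norm_vabs x : `|vabs x| = `|x|.
Proof.
apply/le_anti/andP; split; apply: vle_norm;
  by rewrite -!/(vabs _) vabs_id vle_refl.
Qed.

Lemma norm_vabs_le x y : vle (vabs x) (vabs y) -> `|x| <= `|y|.
Proof. exact: vle_norm. Qed.

Lemma norm_vabsB x y : `|vabs x - vabs y| <= `|x - y|.
Proof. exact/norm_vabs_le/vabsB. Qed.

(** Subtract twice: if t is the left side, then t - w lies below u and v, hence below [vinf u v];
    therefore t - [vinf u v] lies below both u and w. *)
Lemma vinfDr u v w : vle 0 u -> vle 0 v -> vle 0 w ->
  vle (vinf u (v + w)) (vinf u v + vinf u w).
Proof.
move=> u0 v0 w0; set t := vinf u _.
have tu : vle t u by exact: vinf_lel.
have up z : vle 0 z -> vle t (z + u).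
  by move=> z0; rewrite -[t]add0r; exact: vleD.
have H1 : vle t (vinf u v + w).
  by rewrite -vle_subl vle_inf !vle_subl [u + w]addrC up//= vinf_ler.
rewrite [vinf u v + _]addrC -vle_subl vle_inf !vle_subl [u + _]addrC.
by rewrite up ?vle_inf ?u0//= [w + _]addrC.
Qed.

Lemma vdisjointC x y : vdisjoint x y -> vdisjoint y x.
Proof. by rewrite /vdisjoint vinfC. Qed.

Lemma vinf_mono u v v' : vle v v' -> vle (vinf u v) (vinf u v').
Proof.
by move=> vv'; rewrite vle_inf vinf_lel (vle_chain (vinf_ler _ _) vv').
Qed.

Lemma vdisjointDr x y z : vdisjoint x y -> vdisjoint x z -> vdisjoint x (y + z).
Proof.
rewrite /vdisjoint => xy xz; apply: vle_eq; last by rewrite vle_inf !vabs_ge0.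
apply: (vle_chain (vinf_mono _ (vabsD y z))).
by apply: (vle_chain (vinfDr _ _ _)); rewrite ?vabs_ge0// xy xz addr0 vle_refl.
Qed.

Lemma vleZl a b x : a <= b -> vle 0 x -> vle (a *: x) (b *: x).
Proof.
move=> ab x0; rewrite -[a *: x]add0r -vle_subr -scalerBl -(scaler0 _ (b - a)).
by apply: vleZ; rewrite ?subr_ge0.
Qed.

Lemma vdisjointx0 x : vdisjoint x 0.
Proof.
apply: vle_eq; last by rewrite vle_inf !vabs_ge0.
by apply: (vle_chain (vinf_ler _ _)); rewrite vabs_pos vle_refl.
Qed.

(** Natural multiples are repeated sums, which stay disjoint from x; a real scalar is dominated by a
    natural number above its absolute value. *)
Lemma vdisjointZr a x y : vdisjoint x y -> vdisjoint x (a *: y).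
Proof.
move=> xy; have xyn n : vdisjoint x (n%:R *: y).
  elim: n => [|n IH]; first by rewrite scale0r; exact: vdisjointx0.
  by rewrite -natr1 scalerDl scale1r; exact: vdisjointDr.
apply: vle_eq; last by rewrite vle_inf !vabs_ge0.
rewrite -[X in vle _ X](xyn (Num.bound `|a|)); apply: vinf_mono.
rewrite !vabsZ; apply: vleZl; last exact: vabs_ge0.
by rewrite [`|_%:R|]ger0_norm ?ler0n// ltW// archi_boundP.
Qed.

Lemma vdisjoint_sumr x (n : nat) (y : nat -> X) :
  (forall i, (i < n)%N -> vdisjoint x (y i)) -> vdisjoint x (\sum_(i < n) y i).
Proof.
move=> xy; rewrite big_seq; elim/big_ind: _ => [|u v|i _].
- exact: vdisjointx0.
- exact: vdisjointDr.
- exact: xy.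
Qed.

(** For disjoint vectors the formula for [vinf] gives |x| + |y| = ||x| - |y||, and the right side is
    at most |x + y|. *)
Lemma vabsD_disjoint x y : vdisjoint x y -> vabs (x + y) = vabs x + vabs y.
Proof.
move=> xy; apply: vle_eq; first exact: vabsD.
suff -> : vabs x + vabs y = vabs (vabs x - vabs y).
  by rewrite -{2}[y]opprK -(vabsN y) vabsB.
have := vinf_abs (vabs x) (vabs y); rewrite [vinf _ _]xy => /esym/eqP.
by rewrite scaler_eq0 invr_eq0 pnatr_eq0/= subr_eq0 => /eqP.
Qed.

Lemma vabs_sum_disjoint (n : nat) (x : nat -> X) :
  (forall k l, k != l -> vdisjoint (x k) (x l)) ->
  vabs (\sum_(i < n) x i) = \sum_(i < n) vabs (x i).
Proof.
move=> dx; elim: n => [|n IH]; first by rewrite !big_ord0 vabs_pos ?vle_refl.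
rewrite !big_ord_recr/= vabsD_disjoint ?IH//; apply: vdisjointC.
by apply: vdisjoint_sumr => i ni; apply: dx; rewrite gtn_eqF.
Qed.

Lemma vabs_lincomb_disjoint (n : nat) (x : nat -> X) (a : nat -> R) :
  (forall k l, k != l -> vdisjoint (x k) (x l)) ->
  vabs (\sum_(i < n) a i *: x i) = \sum_(i < n) `|a i| *: vabs (x i).
Proof.
move=> dx; rewrite (@vabs_sum_disjoint n (fun i => a i *: x i)) => [|k l kl].
  by apply: eq_bigr => i _; rewrite vabsZ.
by apply/vdisjointZr/vdisjointC/vdisjointZr/vdisjointC/dx.
Qed.

(** Unconditionality with constant 1: the modulus of a combination of disjoint vectors is the
    combination of the moduli with coefficients |a_i|, and the norm is monotone in the modulus. *)
Lemma norm_lincomb_le (n m : nat) (x : nat -> X) (a b : nat -> R) :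
  (forall k l, k != l -> vdisjoint (x k) (x l)) ->
  (n <= m)%N -> (forall i, (i < n)%N -> `|a i| <= `|b i|) ->
  `|\sum_(i < n) a i *: x i| <= `|\sum_(i < m) b i *: x i|.
Proof.
move=> dx nm ab; apply: norm_vabs_le; rewrite !vabs_lincomb_disjoint//.
rewrite -(subnKC nm) big_split_ord/= -[X in vle X _]addr0; apply: vleD.
  elim: n {nm} ab => [|n IH] ab; first by rewrite !big_ord0 vle_refl.
  rewrite !big_ord_recr/=; apply: vleD; last by rewrite vleZl ?vabs_ge0 ?ab.
  by apply: IH => i ni; rewrite ab// ltnW.
elim: (m - n)%N => [|k IH]; first by rewrite !big_ord0 vle_refl.
rewrite big_ord_recr/= -[X in vle X _]addr0; apply: vleD => //.
by rewrite -(scale0r (vabs (x (n + k)%N))) vleZl ?vabs_ge0.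
Qed.

(** Estimates for x_k carry over to |x_k|; positive vectors are what a lattice embedding of l_m
    needs as images of the unit vectors. *)
Lemma norm_lincomb_vabs (n : nat) (x : nat -> X) (a : nat -> R) :
  (forall k l, k != l -> vdisjoint (x k) (x l)) ->
  `|\sum_(i < n) a i *: vabs (x i)| = `|\sum_(i < n) a i *: x i|.
Proof.
move=> dx; rewrite -[LHS]norm_vabs -[RHS]norm_vabs vabs_lincomb_disjoint//.
rewrite (@vabs_lincomb_disjoint n (fun k => vabs (x k))).
  by under eq_bigr do rewrite vabs_id.
by move=> k l kl; rewrite /vdisjoint !vabs_id; exact: dx.
Qed.

End VectorLattice.

(** * Mean value and Taylor inequalities along a line *)

Section LineCalculus.
Context {R : realType}.

Lemma mvt_bound (g dg : R -> R) (t B : R) :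
  (forall s, is_derive s (1:R) g (dg s)) ->
  (forall s, `|s| <= `|t| -> `|dg s| <= B) -> `|g t - g 0| <= `|t| * B.
Proof.
move=> gd dgB.
have gc a b : {within `[a, b], continuous g}.
  by apply: derivable_within_continuous => x _; case: (gd x).
have [t0|t0] := leP 0 t.
  have [c] := MVT_segment t0 (fun x _ => gd x) (gc _ _).
  rewrite in_itv/= => /andP[c0 ct] ->; rewrite subr0 normrM mulrC ler_wpM2l//.
  by apply: dgB; rewrite !ger0_norm.
have [c] := MVT_segment (ltW t0) (fun x _ => gd x) (gc _ _).
rewrite in_itv/= => /andP[ct c0]; rewrite distrC => ->.
rewrite sub0r normrM normrN mulrC ler_wpM2l//.
by apply: dgB; rewrite (ler0_norm c0) (ler0_norm (ltW t0)) lerN2.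
Qed.

Lemma is_derive_taylor_poly (c : nat -> R) m (s : R) :
  is_derive s (1:R) (fun t => \sum_(j < m.+1) t ^+ j / j`!%:R * c j)
    (\sum_(j < m) s ^+ j / j`!%:R * c j.+1).
Proof.
elim: m => [|m IH].
  rewrite big_ord0; rewrite [X in is_derive _ _ X _](_ : _ = cst (c 0%N)).
    exact: is_derive_cst.
  by apply/funext => t; rewrite big_ord1 expr0 fact0 divr1 mul1r.
rewrite big_ord_recr/=.
rewrite [X in is_derive _ _ X _](_ : _ =
  (fun t => \sum_(j < m.+1) t ^+ j / j`!%:R * c j) +
  (c m.+1 / m.+1`!%:R) \*: (fun t => t ^+ m.+1)); last first.
  by apply/funext => t; rewrite big_ord_recr/= [in RHS]fctE/=; congr (_ + _);
     rewrite -[RHS]/(c m.+1 / m.+1`!%:R * t ^+ m.+1); ring.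
apply: is_deriveD.
rewrite (_ : s ^+ m / m`!%:R * c m.+1 =
  (c m.+1 / m.+1`!%:R) *: (m.+1%:R * s ^+ m)).
  apply: is_deriveZ.
  rewrite -[fun t => _]exprfctE.
  have := @is_deriveX _ _ id m.+1 s (1 : R) 1 (is_derive_id _ _).
  by rewrite /GRing.scale/= mulr1.
rewrite /GRing.scale/= factS natrM.
have : (m`!%:R : R) != 0 by rewrite pnatr_eq0 -lt0n fact_gt0.
have : (m.+1%:R : R) != 0 by rewrite pnatr_eq0.
move: (m.+1%:R : R) (m`!%:R : R) => A B A0 B0; field.
by rewrite ?A0 ?B0.
Qed.

Context {X : normedModType R}.
Implicit Types (f : X -> R) (x h : X).

Definition dderive h f : X -> R := fun x => 'D_h f x.

Lemma is_derive_line f x h (t : R) : derivable f (x + t *: h) h ->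
  is_derive t (1:R) (fun s => f (x + s *: h)) ('D_h f (x + t *: h)).
Proof.
move=> df.
have E : (fun s : R => s^-1 *: ((fun s => f (x + s *: h)) (s *: 1 + t) -
    f (x + t *: h))) =
  (fun s : R => s^-1 *: (f (s *: h + (x + t *: h)) - f (x + t *: h))).
  apply/funext => s; congr (_ *: (f _ - _)).
  by rewrite [s%:A]mulr1 scalerDl addrCA.
by apply: DeriveDef; rewrite /derivable /derive [X in X @ _]E.
Qed.

Lemma mvt_line f x h (t B : R) : (forall y, derivable f y h) ->
  (forall s : R, `|s| <= `|t| -> `|'D_h f (x + s *: h)| <= B) ->
  `|f (x + t *: h) - f x| <= `|t| * B.
Proof.
move=> df DB.
have := @mvt_bound (fun s => f (x + s *: h)) (fun s => 'D_h f (x + s *: h)) t B.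
rewrite scale0r addr0; apply => // s; exact: is_derive_line.
Qed.

(** The remainder is measured by the oscillation of the derivative of order m, so no derivative of
    order m + 1 has to exist. By induction: the remainder [g] vanishes at 0 and its derivative [dg]
    is the remainder of one order less for 'D_h f. *)
Lemma taylor_line m f x h (t B : R) :
  (forall j, (j < m)%N -> forall y, derivable (iter j (dderive h) f) y h) ->
  (forall s : R, `|s| <= `|t| ->
     `|iter m (dderive h) f (x + s *: h) - iter m (dderive h) f x| <= B) ->
  `|f (x + t *: h) - \sum_(j < m.+1) t ^+ j / j`!%:R * iter j (dderive h) f x|
    <= `|t| ^+ m * B.
Proof.
elim: m f t => [|m IH] f t df fB.
  by rewrite big_ord1/= expr0 fact0 divr1 !mul1r fB.
set c := fun j => iter j (dderive h) f x.
pose g s := f (x + s *: h) - \sum_(j < m.+2) s ^+ j / j`!%:R * c j.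
pose dg s := 'D_h f (x + s *: h) - \sum_(j < m.+1) s ^+ j / j`!%:R * c j.+1.
have gd s : is_derive s (1:R) g (dg s).
  apply: is_deriveB; last exact: is_derive_taylor_poly.
  by apply: is_derive_line; exact: (df 0%N).
have g0 : g 0 = 0.
  rewrite /g scale0r addr0 big_ord_recl/= expr0 fact0 divr1 mul1r /c/=.
  by rewrite big1 ?addr0 ?subrr// => i _; rewrite expr0n/= mul0r mul0r.
rewrite -[X in `|X|]/(g t) -[g t]subr0 -g0 exprS -mulrA.
apply: (mvt_bound gd) => s st.
apply: (@le_trans _ _ (`|s| ^+ m * B)).
  rewrite /dg /c; under eq_bigr do rewrite iterSr.
  apply: (IH (dderive h f)) => [j jm y|s' s's]; rewrite -iterSr; first exact: df.
  by apply: fB; exact: le_trans s's st.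
apply: ler_wpM2r; last by rewrite lerXn2r ?nnegrE.
(* The hypothesis at s = 0 shows that [B] is nonnegative. *)
by apply: le_trans (fB 0 _); rewrite ?normr0.
Qed.

End LineCalculus.

(** * Frechet derivatives after composition with a bounded linear map *)

Section PostComposition.
Context {R : realType} {V : normedModType R}.

Lemma linear_bound_continuous (W W' : normedModType R) (L : {linear W -> W'})
  (K : R) : (forall w, `|L w| <= K * `|w|) -> continuous L.
Proof.
move=> LK; apply/linear_bounded_continuous/bounded_funP => r.
have [K0|K0] := leP 0 K.
  by exists (K * r) => w wr; apply: le_trans (LK w) _; rewrite ler_wpM2l.
exists 0 => w _; apply: le_trans (LK w) _.
by rewrite mulr_le0_ge0 ?normr_ge0// ltW.
Qed.

Section Post.
Variables (W W' : normedModType R) (L : {linear W -> W'}) (K : R).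
Hypothesis LK : forall w, `|L w| <= K * `|w|.

Lemma post_subproof (A : contLin V W) : (L \o A) \in @clin R V W'.
Proof.
rewrite inE; split=> [a u v|x]; first by rewrite /= !linearP.
by apply: continuous_comp;
  [exact: clin_continuous|exact: linear_bound_continuous LK _].
Qed.

Definition post (A : contLin V W) : contLin V W' := ContLin (post_subproof A).

Lemma post_linear : linear post.
Proof.
by move=> a A B; apply/val_inj/funext => x; rewrite /= linearP.
Qed.

HB.instance Definition _ :=
  GRing.isLinear.Build R (contLin V W) (contLin V W') *:%R post post_linear.

Lemma post_bound (A : contLin V W) : 0 <= K -> `|post A| <= K * `|A|.
Proof.
move=> K0; apply: opnorm_le => x x1; apply: le_trans (LK _) _.
by rewrite ler_wpM2l// opnorm_ub.
Qed.

Lemma frechet_post (f : V -> W) : (forall x, differentiable f x) ->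
  (forall x, differentiable (L \o f) x) /\ frechet (L \o f) = post \o frechet f.
Proof.
move=> df.
have Lc : continuous L by exact: linear_bound_continuous LK.
have dLf x : differentiable (L \o f) x.
  by apply: differentiable_comp => //; exact: linear_differentiable.
split=> //; apply/funext => x; apply/val_inj => /=.
rewrite frechetE// diff_comp//; last exact: linear_differentiable.
by rewrite diff_lin// frechetE.
Qed.

End Post.

(** Induction through [frechet (L \o f) = post \o frechet f]: the next step has values in L(V, W),
    and [post] has the same bound [K] as [L]. Hence the target spaces and [L] vary in the
    induction. *)
Lemma nfrechet_post n (W W' : normedModType R) (L : {linear W -> W'}) (K : R)
    (f : V -> W) : 0 <= K -> (forall w, `|L w| <= K * `|w|) ->
  nfrechet_differentiable n f ->
  nfrechet_differentiable n (L \o f) /\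
  forall x y, `|nfrechet n (L \o f) x - nfrechet n (L \o f) y| <=
              K * `|nfrechet n f x - nfrechet n f y|.
Proof.
elim: n => [|n IH] in W W' L f *; move=> K0 LK.
  by move=> _; split=> // x y; rewrite /= -linearB.
move=> [df ddf]; have [dLf fLf] := frechet_post LK df.
have [H1 H2] := IH _ _ (post LK) (frechet f) K0 (post_bound LK ^~ K0) ddf.
by split=> [|x y]; rewrite /= fLf.
Qed.

Lemma nfrechetS_dist n (W : normedModType R) (f : V -> W) (x y : V) :
  `|nfrechet n.+1 f x - nfrechet n.+1 f y| =
  `|nfrechet n (frechet f) x - nfrechet n (frechet f) y|.
Proof. by []. Qed.

Section Evaluation.
Variables (W : normedModType R) (h : V).

Definition evalat (A : contLin V W) : W := A h.

Lemma evalat_linear : linear evalat.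
Proof. by []. Qed.

HB.instance Definition _ :=
  GRing.isLinear.Build R (contLin V W) W *:%R evalat evalat_linear.

Lemma evalat_bound (A : contLin V W) : `|evalat A| <= `|h| * `|A|.
Proof. by rewrite mulrC; exact: opnormP. Qed.

End Evaluation.

End PostComposition.

(** * From iterated Frechet derivatives to iterated directional derivatives *)

Section SmoothClass.
Context {R : realType} {X : normedModType R}.
Implicit Types (f : X -> R) (x y h : X) (C : R).

(* Trades the Frechet derivatives for iterated directional ones: real-valued
   calculus on lines then suffices. *)
Fixpoint smooth_class (beta r : R) (n : nat) C f : Prop :=
  (forall x, r < `|x| -> f x = 0) /\
  if n is m.+1 then
    (forall x h, derivable f x h) /\
    (forall h, smooth_class beta r m (C * `|h|) (dderive h f))
  else forall x y, `|f x - f y| <= C * `|x - y| `^ beta.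

Lemma dderive_vanish f r x h : (forall y, r < `|y| -> f y = 0) -> r < `|x| ->
  dderive h f x = 0.
Proof.
move=> f0 rx; rewrite /dderive -(derive_cst (0 : R) x h).
apply: near_eq_derive.
have : \forall y \near x, r < `|y|.
  by apply: (cvgr_norm_gt x) => //; exact: cvg_id.
by apply: filterS => y /f0.
Qed.

Lemma ler_mulC_trans (a b c d w : R) : 0 <= a -> b <= a * c -> c <= d * w ->
  b <= d * a * w.
Proof.
by move=> a0 bc cw; rewrite (le_trans bc)// [d * a]mulrC -mulrA ler_wpM2l.
Qed.

(** The directional derivative along h is the Frechet derivative followed by evaluation at h, a
    linear map of bound |h|; this is the factor gained by the constant at each order. *)
Lemma nfrechet_smooth_class (beta r : R) n C f :
  nfrechet_differentiable n f ->
  (forall x y, `|nfrechet n f x - nfrechet n f y| <= C * `|x - y| `^ beta) ->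
  (forall x, r < `|x| -> f x = 0) -> smooth_class beta r n C f.
Proof.
elim: n => [|n IH] in C f *; first by move=> _ H f0; split.
move=> [df ddf] H f0; split=> //; split=> [x h|h].
  exact: diff_derivable.
pose L : {linear contLin X R -> R} := evalat h.
have fE : dderive h f = L \o frechet f.
  by apply/funext => x; rewrite /dderive deriveE//= /evalat frechetE.
have [d1 H1] := nfrechet_post (L := L) (normr_ge0 h) (evalat_bound h) ddf.
rewrite -fE in d1 H1.
apply: IH => [//|x y|x rx]; last exact: dderive_vanish rx.
apply: (ler_mulC_trans (normr_ge0 h) (H1 x y)).
by rewrite -nfrechetS_dist.
Qed.

End SmoothClass.

(** * Uniform bounds, moduli of continuity and even Taylor expansions *)

Section SmoothClassTheory.
Context {R : realType} {X : normedModType R}.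
Variables (beta r : R) (N : nat) (e : X).
Hypotheses (beta0 : 0 < beta) (r0 : 0 <= r) (e1 : `|e| = 1).
Implicit Types (f : X -> R) (x y h u : X) (C : R).

Local Notation q := (2 * r + 1).
Let q1 : 1 <= q. Proof. by rewrite lerDr mulr_ge0. Qed.
Let q0 : 0 < q. Proof. exact: lt_le_trans ltr01 q1. Qed.

(* f vanishes at distance at least 2r + 1 from x in the direction of any unit
   vector e, so each order of differentiation costs a factor 2r + 1. *)
Definition sclass_bound : R := q ^+ N * q `^ beta.

(** One modulus for all orders up to N: the linear term serves functions that still have a
    derivative in the class, the power term the Holder functions of order 0. *)
Definition sclass_modulus (d : R) : R := sclass_bound * d + d `^ beta.

Lemma sclass_vanish n C f x : smooth_class beta r n C f -> r < `|x| -> f x = 0.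
Proof. by case: n => [|n] [f0 _]; exact: f0. Qed.

Lemma sclass_dderive n C f h : smooth_class beta r n.+1 C f ->
  smooth_class beta r n (C * `|h|) (dderive h f).
Proof. by case=> _ [_]; exact. Qed.

Lemma sclass_iter n j C f h : (j <= n)%N -> smooth_class beta r n C f ->
  smooth_class beta r (n - j) (C * `|h| ^+ j) (iter j (dderive h) f).
Proof.
elim: j => [|j IH] jn Cf; first by rewrite subn0 expr0 mulr1.
rewrite iterS exprSr mulrA; apply: sclass_dderive.
by rewrite -subSn//; exact: IH (ltnW jn) Cf.
Qed.

Lemma sclass_derivable n j C f x h : (j < n)%N -> smooth_class beta r n C f ->
  derivable (iter j (dderive h) f) x h.
Proof.
move=> jn Cf; have := sclass_iter h (ltnW jn) Cf.
by rewrite -(subnSK jn)/= => -[_ [+ _]].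
Qed.

Lemma far_translate x : `|x| <= r -> r < `|x + q *: e|.
Proof.
move=> xr; rewrite -[x]opprK addrC; apply: lt_le_trans (lerB_dist _ _).
rewrite normrN normrZ e1 mulr1 ger0_norm ?(ltW q0)//.
by move: xr r0; lra.
Qed.

(** Compares f x with the value 0 at x + q e, by the Holder condition at order 0 and by the mean
    value inequality along e at higher orders. *)
Lemma sclass_bound_aux n C f x : 0 <= C -> smooth_class beta r n C f ->
  `|f x| <= C * (q ^+ n * q `^ beta).
Proof.
elim: n => [|n IH] in C f x *; move=> C0 Cf.
all: have [rx|xr] := ltP r `|x|;
  first by rewrite (sclass_vanish Cf rx) normr0 !mulr_ge0 ?powR_ge0// exprn_ge0// ltW.
all: have fx0 := sclass_vanish Cf (far_translate xr).
  have [_ /(_ x (x + q *: e))] := Cf.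
  rewrite fx0 subr0 opprD addNKr normrN normrZ e1 mulr1 gtr0_norm// expr0 mul1r.
  exact.
have [_ [df ddf]] := Cf.
have -> : `|f x| = `|f (x + q *: e) - f x| by rewrite fx0 sub0r normrN.
apply: le_trans (mvt_line (fun y => df y e) (B := C * (q ^+ n * q `^ beta)) _) _.
  by move=> s _; have := ddf e; rewrite e1 mulr1; exact: IH.
by rewrite gtr0_norm// exprS le_eqVlt; apply/orP; left; apply/eqP; ring.
Qed.

Lemma sclass_bounded n C f x : (n <= N)%N -> 0 <= C ->
  smooth_class beta r n C f -> `|f x| <= C * sclass_bound.
Proof.
move=> nN C0 Cf; apply: le_trans (sclass_bound_aux x C0 Cf) _.
rewrite ler_wpM2l// ler_wpM2r ?powR_ge0//.
(* Since q >= 1, the powers of q increase with the order. *)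
by rewrite ler_weXn2l.
Qed.

Lemma sclass_modulus_ge0 d : 0 <= d -> 0 <= sclass_modulus d.
Proof.
by move=> d0; rewrite addr_ge0 ?powR_ge0// !mulr_ge0 ?powR_ge0// exprn_ge0// ltW.
Qed.

Lemma sclass_bound_ge0 : 0 <= sclass_bound.
Proof. by rewrite mulr_ge0 ?powR_ge0// exprn_ge0// ltW. Qed.

Lemma sclass_equicontinuous n C f x y : (n <= N)%N -> 0 <= C ->
  smooth_class beta r n C f -> `|f x - f y| <= C * sclass_modulus `|x - y|.
Proof.
case: n => [|n] nN C0 Cf.
  apply: le_trans (proj2 Cf x y) _; rewrite ler_wpM2l// lerDr.
  by rewrite mulr_ge0// sclass_bound_ge0.
have [_ [df ddf]] := Cf.
have := @mvt_line _ _ f y (x - y) 1 (C * `|x - y| * sclass_bound)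
  (fun z => df z (x - y)).
rewrite scale1r [y + _]addrC subrK normr1 mul1r => /(_ _)/le_trans; apply.
  move=> s _; rewrite -[derive f _ _]/(dderive (x - y) f _).
  apply: (sclass_bounded _ (ltnW nN)); first by rewrite mulr_ge0.
  exact: ddf.
by rewrite -mulrA ler_wpM2l// mulrC lerDl powR_ge0.
Qed.

Lemma sclass_iter_bounded n j C f u x : (j <= n)%N -> (n <= N)%N -> 0 <= C ->
  `|u| = 1 -> smooth_class beta r n C f ->
  `|iter j (dderive u) f x| <= C * sclass_bound.
Proof.
move=> jn nN C0 u1 Cf.
apply: (@sclass_bounded (n - j)) => //; first by rewrite (leq_trans (leq_subr _ _)).
by have := sclass_iter u jn Cf; rewrite u1 expr1n mulr1.
Qed.

Lemma sclass_iter_equicontinuous n j C f u x y : (j <= n)%N -> (n <= N)%N ->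
  0 <= C -> `|u| = 1 -> smooth_class beta r n C f ->
  `|iter j (dderive u) f x - iter j (dderive u) f y|
    <= C * sclass_modulus `|x - y|.
Proof.
move=> jn nN C0 u1 Cf.
apply: (@sclass_equicontinuous (n - j)) => //.
  by rewrite (leq_trans (leq_subr _ _)).
by have := sclass_iter u jn Cf; rewrite u1 expr1n mulr1.
Qed.

Lemma sclass_modulus_le d d' : 0 <= d -> d <= d' ->
  sclass_modulus d <= sclass_modulus d'.
Proof.
move=> d0 dd'; rewrite lerD ?ler_wpM2l ?sclass_bound_ge0//.
by rewrite ge0_ler_powR// ?ltW// nnegrE// (le_trans d0).
Qed.

Lemma sclass_taylor m C f u x (t : R) : (m <= N)%N -> 0 <= C -> `|u| = 1 ->
  smooth_class beta r N C f ->
  `|f (x + t *: u) - \sum_(j < m.+1) t ^+ j / j`!%:R * iter j (dderive u) f x|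
    <= `|t| ^+ m * (C * sclass_modulus `|t|).
Proof.
move=> mN C0 u1 Cf; apply: taylor_line => [j jm y|s st].
  by apply: sclass_derivable Cf; exact: leq_trans mN.
apply: le_trans (sclass_iter_equicontinuous _ _ mN _ _ _ Cf) _ => //.
rewrite ler_wpM2l// [_ - x]addrC addKr normrZ u1 mulr1.
exact: sclass_modulus_le.
Qed.

Definition even_avg f u x (t : R) : R :=
  2^-1 * (f (x + t *: u) + f (x - t *: u)) - f x.

Lemma even_taylor m C f u x (t : R) : (m <= N)%N -> 0 <= C -> `|u| = 1 ->
  smooth_class beta r N C f ->
  `|even_avg f u x t -
    \sum_(1 <= j < m.+1 | ~~ odd j) t ^+ j / j`!%:R * iter j (dderive u) f x|
    <= `|t| ^+ m * (C * sclass_modulus `|t|).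
Proof.
move=> mN C0 u1 Cf.
have H1 := sclass_taylor x t mN C0 u1 Cf.
have := sclass_taylor x (- t) mN C0 u1 Cf.
rewrite normrN scaleNr => H2.
set P := \sum_(j < m.+1) _ in H1; set Q := \sum_(j < m.+1) _ in H2.
set S := \sum_(1 <= j < m.+1 | _) _.
(* In the sum of the expansions at t and -t the odd terms cancel and the even ones double. *)
have PQ : P + Q = 2 * (f x + S).
  rewrite /P /Q /S -big_split/= big_ord_recl/= !expr0 fact0 divr1 !mul1r.
  rewrite [RHS]mulrDr; congr (_ + _); first by ring.
  rewrite big_add1/= big_mkord big_distrr/= [RHS]big_mkcond/=.
  apply: eq_bigr => i _; rewrite /bump/= add1n exprNn -signr_odd/=.
  by case: (odd i) => /=; rewrite ?expr1 ?expr0; ring.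
rewrite (_ : even_avg f u x t - S =
  2^-1 * ((f (x + t *: u) - P) + (f (x - t *: u) - Q))).
  rewrite normrM ger0_norm ?invr_ge0// mulrC ler_pdivrMr//.
  apply: le_trans (ler_normD _ _) _; rewrite mulrDr mulr1.
  exact: lerD.
rewrite /even_avg; have -> : S = 2^-1 * (P + Q) - f x.
  by rewrite PQ mulrA mulVf ?pnatr_eq0// mul1r [f x + S]addrC addrK.
by ring.
Qed.

End SmoothClassTheory.

(** * Subsequences chosen recursively, uniform smallness on cubes, greedy signs *)

Lemma extract_subseq (P : seq nat -> nat -> Prop) :
  (forall l m, exists2 n, (m <= n)%N & P l n) ->
  exists2 s : nat -> nat, {homo s : k l / (k < l)%N} &
    forall n, P (mkseq s n) (s n).
Proof.
move=> Pex.
(* An index above the sum of the chosen ones is above each of them, so the subsequence is strictly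
   increasing. *)
have /choice[g gP] : forall l, exists n, (sumn l < n)%N /\ P l n.
  by move=> l; have [n ln Pn] := Pex l (sumn l).+1; exists n.
pose L := fix L n := if n is m.+1 then rcons (L m) (g (L m)) else [::].
pose s n := g (L n).
have LE n : L n = mkseq s n by elim: n => //= n IH; rewrite mkseqS -IH.
exists s => [k l kl|n]; last by rewrite -LE; exact: (gP _).2.
have : s k \in L l by rewrite LE; apply/mapP; exists k; rewrite ?mem_iota.
rewrite /s => skl; apply: leq_ltn_trans (gP (L l)).1.
elim: (L l) skl => //= a t IH; rewrite inE => /predU1P[->|/IH].
  exact: leq_addr.
by move=> /leq_trans; apply; exact: leq_addl.
Qed.

Section Averaging.
Context {R : realType}.

Lemma sum_halves_le (c : R) n : 0 <= c -> \sum_(k < n) c / 2 ^+ k.+1 <= c.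
Proof.
move=> c0; suff -> : \sum_(k < n) c / 2 ^+ k.+1 = c - c / 2 ^+ n.
  by rewrite gerBl divr_ge0// exprn_ge0.
elim: n => [|n IH]; first by rewrite big_ord0 expr0 divr1 subrr.
rewrite big_ord_recr/= IH exprS.
have : (2 ^+ n : R) != 0 by rewrite expf_neq0// pnatr_eq0.
by move: (2 ^+ n : R) => u u0; field.
Qed.

Section Uniform.
Context {X : normedModType R}.

(** Pointwise smallness and equicontinuity give uniform smallness on a cube, by induction on its
    dimension: the last coefficient is rounded to a finite grid, at the cost of half of eps. *)
Lemma uniform_small (F : nat -> X -> R) :
  (forall eps, 0 < eps -> exists2 d, 0 < d &
     forall n y z, `|y - z| <= d -> F n y <= F n z + eps) ->
  (forall eps y, 0 < eps -> \forall n \near \oo, F n y <= eps) ->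
  forall k (v : nat -> X) eps y, (forall i, `|v i| = 1) -> 0 < eps ->
  \forall n \near \oo, forall a : nat -> R, (forall i, `|a i| <= 1) ->
    F n (y + \sum_(i < k) a i *: v i) <= eps.
Proof.
move=> Fc F0; elim=> [|k IH] v eps y v1 eps0.
  by apply: filterS (F0 eps y eps0) => n Fn a _; rewrite big_ord0 addr0.
have e20 : 0 < eps / 2 by rewrite divr_gt0.
have [d d0 Fd] := Fc _ e20.
(* The grid points l / M - 1, for l from 0 to 2M, cover [-1, 1] with mesh 1 / M <= d. *)
pose M := (Num.bound d^-1).+1; pose t (l : 'I_(2 * M).+1) : R := l%:R / M%:R - 1.
have M0 : 0 < (M%:R : R) by rewrite ltr0n.
have Md : M%:R^-1 <= d.
  rewrite -[d]invrK lef_pV2 ?posrE ?invr_gt0// ltW//.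
  rewrite (lt_le_trans (archi_boundP _))// ?ler_nat ?leqnSn//.
  by rewrite invr_ge0 ltW.
have : \forall n \near \oo, forall l, forall a : nat -> R, (forall i, `|a i| <= 1) ->
    F n (y + t l *: v k + \sum_(i < k) a i *: v i) <= eps / 2.
  by apply: filter_forall => l; exact: IH.
apply: filterS => n Fn a a1.
have /andP[ak1 ak2] : -1 <= a k <= 1 by rewrite -ler_norml.
have z0 : 0 <= (a k + 1) * M%:R by apply: mulr_ge0; [lra|exact: ltW].
(* Rounding (a_k + 1) M down gives a grid point within 1 / M of a_k. *)
have /andP[l1 l2] := truncn_itv z0.
set l := Num.truncn _ in l1 l2.
have lM : (l < (2 * M).+1)%N.
  rewrite ltnS -(ler_nat R) (le_trans l1)// natrM ler_wpM2r ?(ltW M0)//; lra.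
have tl : `|a k - t (Ordinal lM)| <= d.
  apply: le_trans Md; rewrite /t/= opprB addrCA -[_ - _]addrC.
  rewrite (_ : _ + _ = ((a k + 1) * M%:R - l%:R) / M%:R); last first.
    by field; exact: lt0r_neq0.
  rewrite normrM [`|M%:R^-1|]gtr0_norm ?invr_gt0// -[X in _ <= X]mul1r.
  rewrite ler_wpM2r ?invr_ge0 ?(ltW M0)// ger0_norm ?subr_ge0//.
  by rewrite lerBlDl natr1 ltW.
rewrite big_ord_recr/=.
apply: le_trans (Fd n _ (y + t (Ordinal lM) *: v k + \sum_(i < k) a i *: v i) _) _.
  rewrite (_ : _ - _ = (a k - t (Ordinal lM)) *: v k).
    by rewrite normrZ v1 mulr1.
  rewrite [RHS]scalerBl; move: (\sum_(i < k) _) (_ *: v k) (t _ *: _) => S A T.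
  by rewrite addrA [y + T + S]addrAC opprD addrACA subrr add0r.
by have := Fn (Ordinal lM) a a1; lra.
Qed.

(* One of f (z + a_n x_n), f (z - a_n x_n) is at least their average, so no
   averaging over all signs is needed. *)
Lemma greedy_signs (f : X -> R) (y : X) (x : nat -> X) (a c : nat -> R) n :
  (forall k (b : nat -> bool), (k < n)%N ->
     c k <= even_avg f (x k) (y + \sum_(i < k) ((-1) ^+ b i * a i) *: x i) (a k)) ->
  exists b : nat -> bool, f y + \sum_(i < n) c i <=
    f (y + \sum_(i < n) ((-1) ^+ b i * a i) *: x i).
Proof.
elim: n => [|n IH] H; first by exists xpred0; rewrite !big_ord0 !addr0.
have [b fb] := IH (fun k b kn => H k b (ltnW kn)).
have := H n b (ltnSn n); rewrite /even_avg.
set z := y + _ in fb *; move=> cn.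
pose b' s i := if i == n then s else b i.
have zb s : y + \sum_(i < n.+1) ((-1) ^+ b' s i * a i) *: x i =
    z + ((-1) ^+ s * a n) *: x n.
  rewrite big_ord_recr/= /b' eqxx addrA; congr (y + _ + _).
  by apply: eq_bigr => i _; rewrite ltn_eqF.
have [h|h] := leP (f z + c n) (f (z + a n *: x n)).
  exists (b' false); rewrite zb expr0 mul1r big_ord_recr/=.
  by apply: le_trans h; rewrite addrA lerD2r.
exists (b' true); rewrite zb expr1 mulN1r scaleNr big_ord_recr/= addrA.
by move: fb cn h; lra.
Qed.

End Uniform.

(** * From even averages to upper and lower estimates for disjoint sequences *)

Definition power_sum (rho : R) n (a : nat -> R) : R :=
  \sum_(k < n) `|a k| `^ rho.

Section Estimates.
Context {X : banachLatticeType R}.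
Variables (x : nat -> X) (rho : R).
Hypotheses (xnd : normalized_disjoint x) (rho0 : 0 < rho).

Local Notation pnorm := (power_sum rho).

Let pnorm_ge0 n a : 0 <= pnorm n a.
Proof. by apply: sumr_ge0 => i _; exact: powR_ge0. Qed.

Let pnormZ n a (l : R) : pnorm n (fun i => l * a i) = `|l| `^ rho * pnorm n a.
Proof.
by rewrite /power_sum big_distrr/=; apply: eq_bigr => i _; rewrite normrM powRM.
Qed.

Lemma norm_signs_lincomb n (a : nat -> R) (b : nat -> bool) :
  `|\sum_(i < n) ((-1) ^+ b i * a i) *: x i| = `|\sum_(i < n) a i *: x i|.
Proof.
have sa i : `|(-1) ^+ b i * a i| = `|a i| by rewrite normrM normr_sign mul1r.
apply/le_anti/andP; split.
  apply: (@norm_lincomb_le _ _ n n x (fun i => (-1) ^+ b i * a i) a xnd.2) => //.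
  by move=> i _; rewrite sa.
apply: (@norm_lincomb_le _ _ n n x a (fun i => (-1) ^+ b i * a i) xnd.2) => //.
by move=> i _; rewrite sa.
Qed.

Lemma coef_le_norm n (a : nat -> R) k : (k < n)%N ->
  `|a k| <= `|\sum_(i < n) a i *: x i|.
Proof.
move=> kn; have -> : `|a k| =
    `|\sum_(i < n) (if i == k :> nat then a i else 0) *: x i|.
  rewrite (bigD1 (Ordinal kn))//= eqxx big1 ?addr0 ?normrZ ?xnd.1 ?mulr1// => i ik.
  rewrite ifF ?scale0r//; apply/negbTE; apply: contraNN ik => /eqP ik.
  by apply/eqP/val_inj.
apply: (@norm_lincomb_le _ _ n n x (fun i => if i == k then a i else 0) a xnd.2)
  => // i _.
by case: ifP => // _; rewrite normr0.
Qed.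

(** Both sides are homogeneous, so the coefficients may be rescaled by [l] to make their power sum
    exactly [delta]. *)
Lemma upper_estimate_scale (delta K : R) : 0 < delta ->
  (forall n a, pnorm n a <= delta -> `|\sum_(i < n) a i *: x i| <= K) ->
  upper_estimate rho (K / delta `^ rho^-1) x.
Proof.
move=> d0 H n a; rewrite -/(pnorm n a).
have [S0|S0] := eqVneq (pnorm n a) 0.
  rewrite big1 ?normr0 => [|i _].
    rewrite mulr_ge0 ?powR_ge0// divr_ge0 ?powR_ge0//.
    (* The empty combination shows that [K] is nonnegative. *)
    have := H 0%N a; rewrite /power_sum !big_ord0 normr0; apply; exact: ltW.
  have /eqP := S0; rewrite psumr_eq0 => [/allP/(_ i)|j _]; last exact: powR_ge0.
  rewrite mem_index_enum => /(_ isT)/=; rewrite powR_eq0 normr_eq0.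
  by move=> /andP[/eqP -> _]; rewrite scale0r.
have Sp : 0 < pnorm n a by rewrite lt_neqAle eq_sym S0 pnorm_ge0.
pose l := (delta / pnorm n a) `^ rho^-1.
have l0 : 0 < l by apply: powR_gt0; exact: divr_gt0.
have lE : l = delta `^ rho^-1 / pnorm n a `^ rho^-1.
  rewrite /l powRM ?invr_ge0// ?(ltW d0)// -(powR_inv1 (ltW Sp)) powRAC.
  by rewrite powR_inv1 ?powR_ge0.
have := H n (fun i => l * a i); rewrite pnormZ gtr0_norm//.
rewrite -powRrM mulVf ?gt_eqF// powRr1 ?divr_ge0// ?(ltW d0)// divfK//.
move=> /(_ (lexx _)); under eq_bigr do rewrite -scalerA.
rewrite -scaler_sumr normrZ gtr0_norm// -ler_pdivlMl// => /le_trans; apply.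
by rewrite lE invf_div [leLHS]mulrC mulrA mulrAC.
Qed.

(** The signed coefficients are cut off to 0 from index n on, so that the bound 1 holds at every
    index, as the hypotheses on even averages require. *)
Let signed n (a : nat -> R) (b : nat -> bool) i :
  (forall i, (i < n)%N -> `|a i| <= 1) ->
  `|if (i < n)%N then (-1) ^+ b i * a i else 0| <= 1.
Proof.
by move=> a1; case: ifP => [/a1|_]; rewrite ?normr0// normrM normr_sign mul1r.
Qed.

Let signedE n (a : nat -> R) (b : nat -> bool) k : (k <= n)%N ->
  \sum_(i < k) ((-1) ^+ b i * a i) *: x i =
  \sum_(i < k) (if (i < n)%N then (-1) ^+ b i * a i else 0) *: x i.
Proof.
by move=> kn; apply: eq_bigr => i _; rewrite (leq_trans (ltn_ord i) kn).
Qed.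

(** With greedy signs g loses at most g y / 2 on the way from y to y + w. So g is positive at both
    points, both lie in the ball of radius r, and |w| <= 2r; the signs do not change the norm of the
    combination. *)
Lemma upper_from_even_avg (g : X -> R) (y : X) (r D : R) :
  0 < D -> 0 < g y -> (forall z, r < `|z| -> g z = 0) ->
  (forall k (a : nat -> R) t, (forall i, `|a i| <= 1) -> `|t| <= 1 ->
    - (D * `|t| `^ rho + g y / 4 / 2 ^+ k.+1) <=
      even_avg g (x k) (y + \sum_(i < k) a i *: x i) t) ->
  upper_estimate rho ((r + r) / Num.min 1 (g y / (4 * D)) `^ rho^-1) x.
Proof.
(* The bound 1 in [delta] forces all |a_i| <= 1; the other bound keeps the loss D times the power
   sum below g y / 4. The summable errors cost another g y / 4. *)
move=> D0 gy0 gv gavg; set delta := Num.min _ _.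
have d0 : 0 < delta by rewrite lt_min ltr01 divr_gt0// mulr_gt0.
apply: upper_estimate_scale => // n a ad.
have a1 i : (i < n)%N -> `|a i| <= 1.
  move=> ni; rewrite leNgt; apply/negP => a1.
  have : 1 < `|a i| `^ rho.
    have := @gt0_ltr_powR R rho rho0 1 `|a i|; rewrite powR1 !nnegrE; exact.
  apply/negP; rewrite -leNgt; apply: (@le_trans _ _ delta); last first.
    by rewrite ge_min lexx.
  apply: le_trans ad; rewrite /power_sum (bigD1 (Ordinal ni))//= lerDl.
  by apply: sumr_ge0 => j _; exact: powR_ge0.
have [|b] := @greedy_signs _ g y x a
  (fun k => - (D * `|a k| `^ rho + g y / 4 / 2 ^+ k.+1)) n.
  move=> k b kn; rewrite (signedE _ _ (ltnW kn)).
  apply: (gavg k (fun i => if (i < n)%N then (-1) ^+ b i * a i else 0)) => [i|].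
    exact: signed.
  exact: a1.
rewrite sumrN big_split/= -big_distrr/= -/(pnorm n a).
have h1 : \sum_(i < n) g y / 4 / 2 ^+ i.+1 <= g y / 4.
  by apply: sum_halves_le; rewrite divr_ge0// ltW.
have h2 : D * pnorm n a <= g y / 4.
  have : pnorm n a <= g y / (4 * D).
    by apply: le_trans ad _; rewrite ge_min lexx orbT.
  by rewrite invfM mulrA ler_pdivlMr// mulrC.
set z := \sum_(i < n) _ in h1 *; set w := \sum_(i < n) _ => gw.
have nr v : 0 < g v -> `|v| <= r.
  by move=> gv0; rewrite leNgt; apply/negP => /gv gv1; rewrite gv1 ltxx in gv0.
rewrite -(norm_signs_lincomb n a b) -/w -[w](addKr y) addrC.
apply: le_trans (ler_normB _ _) _; apply: lerD; apply: nr => //.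
by move: gw h1 h2 gy0; lra.
Qed.

(** With greedy signs g gains at least d times the power sum, up to a total error eta, while it can
    vary by at most 2M. *)
Lemma lower_from_even_avg (g : X -> R) (y : X) (M d eta tau : R) :
  0 < d -> 0 <= eta -> 0 < tau <= 1 -> (forall z, `|g z| <= M) ->
  (forall k (a : nat -> R) t, (forall i, `|a i| <= 1) ->
    `|\sum_(i < k) a i *: x i| <= tau -> `|t| <= tau ->
    d * `|t| `^ rho - eta / 2 ^+ k.+1 <=
      even_avg g (x k) (y + \sum_(i < k) a i *: x i) t) ->
  forall n (a : nat -> R), `|\sum_(i < n) a i *: x i| <= tau ->
    pnorm n a <= (2 * M + eta) / d.
Proof.
move=> d0 eta0 /andP[tau0 tau1] gM gavg n a atau.
have at_ i : (i < n)%N -> `|a i| <= tau by move=> /coef_le_norm/le_trans; apply.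
have [|b] := @greedy_signs _ g y x a
  (fun k => d * `|a k| `^ rho - eta / 2 ^+ k.+1) n.
  move=> k b kn; have kn' := ltnW kn.
  rewrite (signedE _ _ kn').
  apply: (gavg k (fun i => if (i < n)%N then (-1) ^+ b i * a i else 0)) => [i||];
    last exact: at_.
    by apply: signed => j /at_/le_trans; apply.
  (* Partial sums with changed signs stay in the ball of radius tau, by unconditionality. *)
  rewrite -signedE// norm_signs_lincomb; apply: le_trans atau.
  exact: (@norm_lincomb_le _ _ k n x a a xnd.2 kn').
rewrite sumrB -big_distrr/= -/(pnorm n a).
have := sum_halves_le n eta0; set z := \sum_(i < n) _; set w := y + _ => zeta gw.
rewrite ler_pdivlMr// mulrC.
have := gM w; have := gM y; rewrite !ler_norml => /andP[? ?] /andP[? ?].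
by lra.
Qed.

(** Homogeneity again: the combination is rescaled to norm [tau]. *)
Lemma lower_estimate_scale (tau K : R) : 0 < tau ->
  (forall n (a : nat -> R), `|\sum_(i < n) a i *: x i| <= tau ->
    pnorm n a <= K) ->
  forall n (a : nat -> R),
    pnorm n a `^ rho^-1 <= K `^ rho^-1 / tau * `|\sum_(i < n) a i *: x i|.
Proof.
move=> tau0 H n a; set w := \sum_(i < n) _.
have [w0|w0] := eqVneq `|w| 0.
  rewrite (_ : pnorm n a = 0) ?powR0 ?invr_neq0 ?gt_eqF// ?w0 ?mulr0//.
  apply: big1 => i _; have := @coef_le_norm n a i (ltn_ord i).
  by rewrite -/w w0 normr_le0 => /eqP ->; rewrite normr0 powR0// gt_eqF.
have wp : 0 < `|w| by rewrite lt_neqAle eq_sym w0 normr_ge0.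
pose l := tau / `|w|; have l0 : 0 < l by rewrite divr_gt0.
have := H n (fun i => l * a i); under eq_bigr do rewrite -scalerA.
rewrite -scaler_sumr normrZ -/w gtr0_norm// /l divfK// => /(_ (lexx _)).
rewrite pnormZ -/l gtr0_norm// => h.
have : (l `^ rho * pnorm n a) `^ rho^-1 <= K `^ rho^-1.
  have h0 : 0 <= l `^ rho * pnorm n a by rewrite mulr_ge0 ?powR_ge0.
  by rewrite ge0_ler_powR ?invr_ge0 ?(ltW rho0)// nnegrE// (le_trans h0).
rewrite powRM ?powR_ge0// -powRrM mulfV ?gt_eqF// powRr1 ?(ltW l0)//.
rewrite -ler_pdivlMl// => /le_trans; apply.
by rewrite /l invf_div [leLHS]mulrC mulrA mulrAC.
Qed.

End Estimates.
End Averaging.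

(** * The norm of l_r as the supremum over finite truncations *)

Section EllNorm.
Context {R : realType} (r : R) (r1 : (1 <= r%:E)%E).
Implicit Types a : ell r1.

Let r0 : 0 < r. Proof. by rewrite (lt_le_trans ltr01)// -lee_fin. Qed.

Lemma ell_power_sum_le a n : power_sum r n a `^ r^-1 <= `|a|.
Proof.
rewrite -lee_fin ell_normE -poweR_EFin.
have s0 m : (0%:E <= \sum_(0 <= k < m) (`|a k| `^ r)%:E)%E.
  by apply: sume_ge0 => k _; rewrite lee_fin powR_ge0.
have sl : (\sum_(0 <= k < n) (`|a k| `^ r)%:E <=
           \sum_(0 <= k <oo) (`|a k| `^ r)%:E)%E.
  by apply: nneseries_lim_ge => k _ _; rewrite lee_fin powR_ge0.
have -> : (power_sum r n a)%:E = (\sum_(0 <= k < n) (`|a k| `^ r)%:E)%E.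
  by rewrite /power_sum -sumEFin big_mkord.
apply: gt0_ler_poweR; rewrite ?invr_ge0 ?(ltW r0)// in_itv/= leey andbT.
  exact: s0.
exact: le_trans (s0 n) sl.
Qed.

Lemma ell_norm_le a M : (forall n, power_sum r n a `^ r^-1 <= M) -> `|a| <= M.
Proof.
move=> aM; have M0 : 0 <= M by apply: le_trans (aM 0%N); exact: powR_ge0.
rewrite -lee_fin ell_normE.
have -> : M = (M `^ r) `^ r^-1.
  by rewrite -powRrM mulfV ?gt_eqF// powRr1.
rewrite -poweR_EFin.
have sM : (\sum_(0 <= k <oo) (`|a k| `^ r)%:E <= (M `^ r)%:E)%E.
  apply: lime_le; first by apply: is_cvg_nneseries => k _ _; rewrite lee_fin powR_ge0.
  near=> n; rewrite big_mkord sumEFin lee_fin -/(power_sum r n a).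
  have S0 : 0 <= power_sum r n a by apply: sumr_ge0 => k _; exact: powR_ge0.
  rewrite -[leLHS]powRr1// -[X in _ `^ X <= _](mulVf (lt0r_neq0 r0)) powRrM.
  by apply: ge0_ler_powR; rewrite ?nnegrE ?powR_ge0// ltW.
apply: gt0_ler_poweR; rewrite ?invr_ge0 ?(ltW r0)// in_itv/= leey andbT.
  by apply: nneseries_ge0 => k _ _; rewrite lee_fin powR_ge0.
by rewrite lee_fin powR_ge0.
Unshelve. all: by end_near. Qed.

Lemma ell_cvg_power_series a : cvgn (series (fun k => `|a k| `^ r)).
Proof.
apply: nondecreasing_is_cvgn.
  apply/nondecreasing_seqP => n; rewrite /series/= big_nat_recr//= lerDl.
  exact: powR_ge0.
exists (`|a| `^ r) => _ [n _ <-]; rewrite /series/= big_mkord -/(power_sum r n a).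
have S0 : 0 <= power_sum r n a by apply: sumr_ge0 => k _; exact: powR_ge0.
rewrite -[leLHS]powRr1// -[X in _ `^ X <= _](mulVf (lt0r_neq0 r0)) powRrM.
by apply: ge0_ler_powR; rewrite ?nnegrE ?powR_ge0 ?ell_power_sum_le// ltW.
Qed.

End EllNorm.

(** * The lattice embedding of l_r spanned by the moduli of a disjoint sequence *)

Section Embedding.
Context {R : realType} {X : banachLatticeType R}.
Variables (r : R) (r1 : (1 <= r%:E)%E) (x : nat -> X) (C K : R).
Hypotheses (xnd : normalized_disjoint x) (xC : upper_estimate r C x).
Hypothesis xK : forall n (a : nat -> R),
  power_sum r n a `^ r^-1 <= K * `|\sum_(i < n) a i *: x i|.

Let r0 : 0 < r. Proof. by rewrite (lt_le_trans ltr01)// -lee_fin. Qed.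

Let v k := vabs (x k).

Let vnd k l : k != l -> vdisjoint (v k) (v l).
Proof. by move=> kl; rewrite /vdisjoint !vabs_id; exact: xnd.2. Qed.

Let S (a : nat -> R) := series (fun k => a k *: v k).

Let S_norm a n : `|S a n| = `|\sum_(i < n) a i *: x i|.
Proof. by rewrite /S /series/= big_mkord norm_lincomb_vabs//; exact: xnd.2. Qed.

Let S_le a n m : (n <= m)%N -> `|S a n| <= `|S a m|.
Proof. by move=> nm; rewrite !S_norm; exact: (norm_lincomb_le xnd.2). Qed.

(** Cauchy criterion: the upper estimate bounds a block of the vector series by the same block of
    the convergent series of r-th powers. *)
Let S_cvg (a : ell r1) : cvgn (S a).
Proof.
apply/cauchy_cvgP/cauchy_seriesP => e e0.
pose C' := Num.max C 1; have C'0 : 0 < C' by rewrite lt_max ltr01 orbT.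
have := @ell_cvg_power_series _ _ _ a => /cvg_cauchy/cauchy_seriesP.
move=> /(_ ((e / C') `^ r) (powR_gt0 _ (divr_gt0 e0 C'0))).
apply: filterS => -[n m]/=; set s := \sum_(n <= k < m) _.
have s0 : 0 <= s by apply: sumr_ge0 => k _; exact: powR_ge0.
rewrite ger0_norm// => se.
have {se}se : s `^ r^-1 < e / C'.
  have -> : e / C' = ((e / C') `^ r) `^ r^-1.
    by rewrite -powRrM mulfV ?gt_eqF// powRr1// divr_ge0// ltW.
  by apply: gt0_ltr_powR; rewrite ?invr_gt0 ?nnegrE ?powR_ge0.
(* Zeroing the coefficients before n turns the block into an initial partial sum, the form the upper
   estimate speaks of. *)
pose a' k := if (n <= k)%N then a k else 0.
have -> : \sum_(n <= k < m) a k *: v k = S a' m.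
  rewrite /S /series/= big_mkord big_geq_mkord big_mkcond/=.
  by apply: eq_bigr => i _; rewrite /a'; case: ifP => // _; rewrite scale0r.
rewrite S_norm; apply: le_lt_trans (xC m a') _.
have -> : \sum_(k < m) `|a' k| `^ r = s.
  rewrite /s big_geq_mkord [RHS]big_mkcond/=; apply: eq_bigr => i _.
  by rewrite /a'; case: ifP => // _; rewrite normr0 powR0// gt_eqF.
apply: (@le_lt_trans _ _ (C' * s `^ r^-1)).
  by rewrite ler_wpM2r ?powR_ge0// le_max lexx.
by rewrite mulrC -ltr_pdivlMr.
Qed.

Definition ell_embed (a : ell r1) : X := limn (S a).

Let embed_cvg (a : ell r1) : S a @ \oo --> ell_embed a.
Proof. exact: S_cvg. Qed.

Lemma ell_embed_linear : linear ell_embed.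
Proof.
move=> c a b; apply/cvg_lim => //.
have -> : S (c *: a + b : ell r1) = (fun n => c *: S a n + S b n).
  apply/funext => n; rewrite /S /series/= scaler_sumr -big_split/=.
  by apply: eq_bigr => k _; rewrite scalerA -scalerDl.
apply: cvgD; last exact: embed_cvg.
by apply: cvgZl_tmp; exact: embed_cvg.
Qed.

HB.instance Definition _ :=
  GRing.isLinear.Build R (ell r1) X *:%R ell_embed ell_embed_linear.

Lemma ell_embed_upper (a : ell r1) : `|ell_embed a| <= `|C| * `|a|.
Proof.
rewrite -lim_norm; last exact: S_cvg.
apply: limr_le; first by apply: is_cvg_norm; exact: S_cvg.
near=> n; rewrite S_norm; apply: le_trans (xC n a) _.
rewrite -/(power_sum r n a); apply: (@le_trans _ _ (`|C| * power_sum r n a `^ r^-1)).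
  by rewrite ler_wpM2r ?powR_ge0 ?ler_norm.
by rewrite ler_wpM2l ?ell_power_sum_le.
Unshelve. all: by end_near. Qed.

Lemma ell_embed_partial_le (a : ell r1) n : `|S a n| <= `|ell_embed a|.
Proof.
rewrite -lim_norm; last exact: S_cvg.
apply: limr_ge; first by apply: is_cvg_norm; exact: S_cvg.
by exists n => // m /= nm; exact: S_le.
Qed.

Lemma ell_embed_lower (a : ell r1) : `|a| <= `|K| * `|ell_embed a|.
Proof.
apply: ell_norm_le => n; apply: le_trans (xK n a) _; rewrite -S_norm.
apply: (@le_trans _ _ (`|K| * `|S a n|)); first by rewrite ler_wpM2r ?ler_norm.
by rewrite ler_wpM2l// ell_embed_partial_le.
Qed.

(** Disjointness gives the identity for partial sums; it passes to the limit because the modulus is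
    1-Lipschitz for the norm. *)
Lemma ell_embed_abs (a b : ell r1) : (forall n, b n = `|a n|) ->
  ell_embed b = vabs (ell_embed a).
Proof.
move=> ba; apply/cvg_lim => //.
have -> : S b = (fun n => vabs (S a n)).
  apply/funext => n; rewrite /S /series/= !big_mkord vabs_lincomb_disjoint//.
  by apply: eq_bigr => k _; rewrite ba vabs_id.
apply/cvgrPdist_le => e e0.
have /cvgrPdist_le/(_ _ e0) := @embed_cvg a.
apply: filterS => n; exact: le_trans (norm_vabsB _ _).
Qed.

Lemma ell_embed_lattice_hom : ell_lattice_hom ell_embed.
Proof.
move=> a b c; have [d dE] := ell_abs_ex (a - b).
have Td : vabs (ell_embed a - ell_embed b) = ell_embed d.
  by rewrite (ell_embed_abs dE) -linearB.
split=> cE.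
  have -> : c = 2^-1 *: (a + b + d).
    apply/LfuneqP => n; rewrite cE maxr_absE.
    by rewrite -[RHS]/(2^-1 * (a n + b n + d n)) dE mulrC.
  by rewrite vsup_abs Td linearZ/= !linearD.
have -> : c = 2^-1 *: (a + b - d).
  apply/LfuneqP => n; rewrite cE minr_absE.
  by rewrite -[RHS]/(2^-1 * (a n + b n - d n)) dE mulrC.
by rewrite vinf_abs Td linearZ/= linearB/= !linearD.
Qed.

Lemma contains_ell_embed : contains_ell r X.
Proof.
exists r1, ell_embed; split.
- exact: ell_embed_lattice_hom.
- exact: linear_bound_continuous ell_embed_upper.
have inj : injective ell_embed.
  move=> a b ab; apply/eqP; rewrite -subr_eq0 -normr_le0.
  by apply: le_trans (ell_embed_lower _) _; rewrite linearB/= ab subrr normr0 mulr0.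
(* The inverse on the range, extended by 0 elsewhere. *)
have /choice[g gP] : forall z : X, exists a, range ell_embed z -> ell_embed a = z.
  by move=> z; have [[a _ <-]|nz] := pselect (range ell_embed z); [exists a|exists 0].
have gK : cancel ell_embed g by move=> a; apply: inj; apply: gP; exists a.
exists g => //.
apply/subspace_continuousP => z Az; apply/cvgrPdist_le => e e0.
(* |K| + 1 is positive even if K is 0, so it can be divided by. *)
rewrite near_withinE; have K1 : 0 < `|K| + 1 by rewrite ltr_wpDl.
have /cvgrPdist_le/(_ _ (divr_gt0 e0 K1)) : w @[w --> z] --> z by exact: cvg_id.
apply: filterS => w zw Aw.
apply: le_trans (ell_embed_lower _) _; rewrite linearB/= !gP//.
rewrite ler_pdivlMr// mulrC in zw; apply: le_trans zw.
by rewrite ler_wpM2r// lerDl.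
Qed.

End Embedding.

(** * Even derivatives along the sequence and their smallness on a subsequence *)

Section EvenDerivatives.
Context {R : realType} {X : normedModType R}.
Variables (beta r : R) (N : nat) (e : X) (C : R) (f : X -> R).
Hypotheses (beta0 : 0 < beta) (r0 : 0 <= r) (e1 : `|e| = 1) (C0 : 0 <= C).
Hypothesis fC : smooth_class beta r N C f.
Implicit Types (x y z u : X).

Local Notation B := (sclass_bound beta r N).
Local Notation modulus := (sclass_modulus beta r N).

(** Dominates, for all |t| <= 1, the even Taylor terms of positive order below m. *)
Definition even_derivs m u y : R :=
  \sum_(1 <= j < m | ~~ odd j) `|iter j (dderive u) f y|.

Lemma sclass_modulus_small eps : 0 < eps ->
  exists2 d, 0 < d & forall t, 0 <= t -> t <= d -> modulus t <= eps.
Proof.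
move=> eps0; have B0 : 0 <= B by exact: sclass_bound_ge0.
have B1 : 0 < B + 1 by rewrite ltr_wpDl.
have e20 : 0 < eps / 2 by rewrite divr_gt0.
exists (Num.min (eps / 2 / (B + 1)) ((eps / 2) `^ beta^-1)).
  by rewrite lt_min divr_gt0//= powR_gt0.
move=> t t0; rewrite le_min ler_pdivlMr// => /andP[t1 t2].
have h1 : B * t <= eps / 2 by apply: le_trans t1; rewrite mulrC ler_wpM2l// lerDl.
have h2 : t `^ beta <= eps / 2.
  have -> : eps / 2 = ((eps / 2) `^ beta^-1) `^ beta.
    by rewrite -powRrM mulVf ?gt_eqF// powRr1// ltW.
  by rewrite ge0_ler_powR ?nnegrE ?powR_ge0// ltW.
by rewrite /sclass_modulus; move: h1 h2; lra.
Qed.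

Lemma even_derivs_ge0 m u y : 0 <= even_derivs m u y.
Proof. by apply: sumr_ge0. Qed.

Lemma even_derivs_equicontinuous m u y z : (m <= N.+1)%N -> `|u| = 1 ->
  even_derivs m u y <= even_derivs m u z + m%:R * (C * modulus `|y - z|).
Proof.
move=> mN u1; set w := C * _.
have w0 : 0 <= w by rewrite mulr_ge0//; exact: sclass_modulus_ge0.
rewrite -lerBlDl -sumrB.
apply: (@le_trans _ _ (\sum_(1 <= j < m | ~~ odd j) w)).
  rewrite big_nat_cond [leRHS]big_nat_cond; apply: ler_sum => j /andP[/andP[j1 jm] _].
  apply: le_trans (lerB_dist _ _) _.
  have jN : (j <= N)%N by rewrite -ltnS (leq_trans jm).
  exact: (sclass_iter_equicontinuous r0 e1 y z jN (leqnn N) C0 u1 fC).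
rewrite big_mkcond/=; apply: (@le_trans _ _ (\sum_(1 <= j < m) w)).
  by apply: ler_sum => j _; case: ifP.
rewrite sumr_const_nat -[leLHS]mulr_natl ler_wpM2r// ler_nat.
exact: leq_subr.
Qed.

Lemma even_derivs_uniform m (x : nat -> X) eps : (m <= N.+1)%N ->
  (forall n, `|x n| = 1) -> 0 < eps ->
  exists2 d, 0 < d & forall n y z, `|y - z| <= d ->
    even_derivs m (x n) y <= even_derivs m (x n) z + eps.
Proof.
move=> mN x1 eps0.
have c0 : 0 < m%:R * C + 1 by rewrite ltr_wpDl// mulr_ge0.
have [d d0 dP] := sclass_modulus_small (divr_gt0 eps0 c0).
exists d => // n y z yz.
apply: le_trans (even_derivs_equicontinuous y z mN (x1 n)) _.
rewrite lerD2l mulrA; have := dP _ (normr_ge0 _) yz.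
rewrite ler_pdivlMr// => /(le_trans _); apply.
rewrite mulrC ler_wpM2l ?lerDl//; exact: sclass_modulus_ge0.
Qed.

Lemma even_poly_le m u y (t : R) : `|t| <= 1 ->
  `|\sum_(1 <= j < m | ~~ odd j) t ^+ j / j`!%:R * iter j (dderive u) f y|
    <= even_derivs m u y.
Proof.
move=> t1; apply: le_trans (ler_norm_sum _ _ _) _; apply: ler_sum => j _.
rewrite normrM -[leRHS]mul1r ler_wpM2r// normrM normrX.
rewrite -[leRHS]mulr1 ler_pM ?exprn_ile1//.
rewrite normfV ger0_norm// invf_le1 ?ltr0n ?fact_gt0// ler1n.
exact: fact_gt0.
Qed.

Lemma even_avg_top u y (t : R) : `|u| = 1 -> `|t| <= 1 ->
  `|even_avg f u y t| <=
    even_derivs N.+1 u y + `|t| ^+ N * (C * modulus `|t|).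
Proof.
move=> u1 t1; set P := \sum_(1 <= j < N.+1 | ~~ odd j)
  t ^+ j / j`!%:R * iter j (dderive u) f y.
rewrite -[even_avg _ _ _ _](subrK P); apply: le_trans (ler_normD _ _) _.
rewrite addrC; apply: lerD; first exact: even_poly_le.
exact: (even_taylor beta0 r0 e1 y t (leqnn N) C0 u1 fC).
Qed.

(** As m is even, the term of order m is the last one of the even Taylor sum; it is kept exactly and
    the lower ones are absorbed in [even_derivs]. *)
Lemma even_avg_leading m u y (t : R) : (m <= N)%N -> (0 < m)%N -> ~~ odd m ->
  `|u| = 1 -> `|t| <= 1 ->
  `|even_avg f u y t - t ^+ m / m`!%:R * iter m (dderive u) f y| <=
    even_derivs m u y + `|t| ^+ m * (C * modulus `|t|).
Proof.
move=> mN m0 om u1 t1; set P := \sum_(1 <= j < m | ~~ odd j)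
  t ^+ j / j`!%:R * iter j (dderive u) f y.
set T := _ * iter m _ _ _.
have -> : even_avg f u y t - T = P + (even_avg f u y t - (P + T)).
  by rewrite opprD [X in _ = P + X]addrCA addNKr.
apply: le_trans (ler_normD _ _) _.
apply: lerD; first exact: even_poly_le.
have := even_taylor beta0 r0 e1 y t mN C0 u1 fC.
by rewrite big_mkcond big_nat_recr//= om -big_mkcond.
Qed.

Lemma even_avg_scale s u y (t : R) :
  even_avg (fun x => s * f x) u y t = s * even_avg f u y t.
Proof. by rewrite /even_avg; ring. Qed.

End EvenDerivatives.

(** Each new index is taken so late that [F] is small on the whole cube spanned by the vectors
    already chosen; [Q] is a further property that holds for arbitrarily late indices. *)
Lemma small_subseq (R : realType) (X : normedModType R) (F : nat -> X -> R)
    (x : nat -> X) (Q : nat -> Prop) (eta : R) :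
  0 < eta -> (forall n, `|x n| = 1) ->
  (forall eps, 0 < eps -> exists2 d, 0 < d &
     forall n y z, `|y - z| <= d -> F n y <= F n z + eps) ->
  (forall eps y, 0 < eps -> \forall n \near \oo, F n y <= eps) ->
  (forall m, exists2 n, (m <= n)%N & Q n) ->
  exists2 s : nat -> nat, {homo s : k l / (k < l)%N} &
    forall n, Q (s n) /\ forall a : nat -> R, (forall i, `|a i| <= 1) ->
      F (s n) (\sum_(i < n) a i *: x (s i)) <= eta / 2 ^+ n.+1.
Proof.
move=> eta0 x1 Fc F0 Qf.
have [|s s_incr sP] := @extract_subseq (fun l n => Q n /\
  forall a : nat -> R, (forall i, `|a i| <= 1) ->
  F n (\sum_(i < size l) a i *: x (nth 0%N l i)) <= eta / 2 ^+ (size l).+1).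
  move=> l m.
  have e0 : 0 < eta / 2 ^+ (size l).+1 by rewrite divr_gt0// exprn_gt0.
  have [n0 _ Fn0] := uniform_small Fc F0 (size l) 0 (fun i => x1 (nth 0%N l i)) e0.
  have [n mn Qn] := Qf (maxn m n0); exists n.
    by rewrite (leq_trans _ mn)// leq_maxl.
  split=> // a a1; rewrite -[X in F n X]add0r; apply: Fn0 => //=.
  by rewrite (leq_trans _ mn)// leq_maxr.
exists s => // n; have [Qn sn] := sP n; split=> // a a1.
have := sn a a1; rewrite size_mkseq; congr (F _ _ <= _).
by apply: eq_bigr => i _; rewrite nth_mkseq.
Qed.

(** * The two cases: all even derivatives vanish, or one of them does not *)

Section SmoothLattice.
Context {R : realType} {X : banachLatticeType R}.
Variables (p C r : R) (f : X -> R) (y0 : X).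
Local Notation N := (smooth_order p).
Local Notation beta := (p - N%:R).
Local Notation B := (sclass_bound beta r N).
Local Notation modulus := (sclass_modulus beta r N).
Hypotheses (p1 : 1 < p) (C0 : 0 < C) (r0 : 0 < r) (fy0 : f y0 != 0).
Hypothesis fC : smooth_class beta r N C f.

Let beta0 : 0 < beta. Proof. by rewrite subr_gt0 smooth_orderP. Qed.

Let beta1 : beta <= 1.
Proof.
by rewrite lerBlDl natr1 leNgt smooth_orderP// ltnn.
Qed.

Let B0 : 0 <= B. Proof. exact/sclass_bound_ge0/ltW. Qed.

Definition derivs_vanish (x : nat -> X) (j : nat) : Prop :=
  forall (y : X) eps, 0 < eps ->
    \forall n \near \oo, `|iter j (dderive (x n)) f y| <= eps.

Lemma even_derivs_vanish x m :
  (forall j, (0 < j < m)%N -> ~~ odd j -> derivs_vanish x j) ->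
  forall eps y, 0 < eps -> \forall n \near \oo, even_derivs f m (x n) y <= eps.
Proof.
move=> xv eps y eps0.
have e0 : 0 < eps / m.+1%:R by rewrite divr_gt0.
have : \forall n \near \oo, forall j : 'I_m, (0 < j)%N -> ~~ odd j ->
    `|iter j (dderive (x n)) f y| <= eps / m.+1%:R.
  apply: filter_forall => j.
  have [j0|j0] := ltnP 0 j; last exact: nearW.
  have [oj|oj] := boolP (odd j); first exact: nearW.
  have jm : (0 < j < m)%N by rewrite j0 ltn_ord.
  by apply: filterS (xv j jm oj y _ e0) => n.
apply: filterS => n nD.
apply: (@le_trans _ _ (\sum_(1 <= j < m | ~~ odd j) eps / m.+1%:R)).
  rewrite /even_derivs big_nat_cond [leRHS]big_nat_cond.
  apply: ler_sum => j /andP[/andP[j1 jm] oj].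
  exact: (nD (Ordinal jm)).
rewrite big_mkcond/=; apply: (@le_trans _ _ (\sum_(1 <= j < m) eps / m.+1%:R)).
  by apply: ler_sum => j _; case: ifP => // _; exact: ltW.
rewrite sumr_const_nat -[leLHS]mulr_natl mulrCA -[leRHS]mulr1 ler_wpM2l ?(ltW eps0)//.
by rewrite ler_pdivrMr// mul1r ler_nat (leq_trans (leq_subr _ _)).
Qed.

(** The absolute value exceeds some d infinitely often; if the positive sign occurs only finitely
    often, then the negative one occurs infinitely often. *)
Lemma not_derivs_vanish x m : ~ derivs_vanish x m ->
  exists y s d, [/\ `|s| = 1 :> R, 0 < d & forall n0, exists2 n, (n0 <= n)%N &
    d < s * iter m (dderive (x n)) f y].
Proof.
move=> /existsNP[y /existsNP[d /not_implyP[d0 nD]]].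
have H n0 : exists2 n, (n0 <= n)%N & d < `|iter m (dderive (x n)) f y|.
  apply: contrapT => Hn; apply: nD; exists n0 => // n /= n0n.
  by rewrite leNgt; apply/negP => dn; apply: Hn; exists n.
have [Hp|/existsNP[n1 Hn1]] := pselect (forall n0, exists2 n, (n0 <= n)%N &
    d < iter m (dderive (x n)) f y).
  exists y, 1, d; split; rewrite ?normr1// => n0.
  by have [n n0n dn] := Hp n0; exists n; rewrite ?mul1r.
exists y, (-1), d; split; rewrite ?normrN1// => n0.
have [n nn] := H (maxn n0 n1); rewrite ltr_normr => /orP[dn|dn].
  by exfalso; apply: Hn1; exists n; rewrite // (leq_trans _ nn)// leq_maxr.
by exists n; rewrite ?mulN1r// (leq_trans _ nn)// leq_maxl.
Qed.

Local Notation delta D rho := (Num.min 1 (`|f y0| / (4 * D)) `^ rho^-1).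

(** The sign s makes the function positive at [y0] for the upper estimate, or its derivatives of
    order m positive at [y1] for the lower one. *)
Let g s y : R := s * f y.

Let sgf : g (Num.sg (f y0)) y0 = `|f y0|.
Proof. by rewrite /g [`|_|]normrEsg. Qed.

Let sg1 : `|Num.sg (f y0)| = 1.
Proof. by rewrite normr_sg fy0. Qed.

Let fv s z : r < `|z| -> g s z = 0.
Proof. by move=> rz; rewrite /g (sclass_vanish fC rz) mulr0. Qed.

Let gavg_le s x z (t c : R) : `|s| = 1 -> `|even_avg f x z t| <= c ->
  - c <= even_avg (g s) x z t.
Proof.
move=> s1 h; rewrite even_avg_scale.
have : `|s * even_avg f x z t| <= c by rewrite normrM s1 mul1r.
by rewrite ler_norml => /andP[].
Qed.

(** Only the Taylor remainder of order N survives, and it is at most C (B + 1) |t|^p for |t| <= 1.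
    The constant does not depend on the sequence, as the uniform property demands. *)
Lemma upper_of_vanishing (x : nat -> X) : normalized_disjoint x ->
  (forall j, (0 < j < N.+1)%N -> ~~ odd j -> derivs_vanish x j) ->
  exists2 s : nat -> nat, {homo s : k l / (k < l)%N} &
    upper_estimate p ((r + r) / delta (C * (B + 1)) p) (x \o s).
Proof.
move=> xnd xv; have x1 := xnd.1.
have eta0 : 0 < `|f y0| / 4 by rewrite divr_gt0// normr_gt0.
pose F n y := even_derivs f N.+1 (x n) (y0 + y).
have [|eps y eps0|n|s s_incr sP] := small_subseq (F := F) (Q := fun=> True) eta0 x1.
- move=> eps eps0.
  have [d d0 dP] := even_derivs_uniform beta0 (ltW r0) (x1 0%N) (ltW C0) fC
    (leqnn _) x1 eps0.
  exists d => // n y z yz; apply: dP.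
  by rewrite opprD addrACA subrr add0r.
- exact: even_derivs_vanish.
- by exists n.
exists s => //; have xsnd : normalized_disjoint (x \o s).
  split=> [k|k l kl]; first exact: x1.
  apply: xnd.2; rewrite neq_ltn; have := kl; rewrite neq_ltn.
  by move=> /orP[/s_incr->//|/s_incr->]; rewrite orbT.
have D0 : 0 < C * (B + 1) by rewrite mulr_gt0// ltr_wpDl.
rewrite -sgf; apply: (upper_from_even_avg xsnd (lt_trans ltr01 p1) D0 _ (@fv _)).
  by rewrite sgf normr_gt0.
move=> k a t a1 t1; rewrite sgf; apply: gavg_le => //.
apply: le_trans (even_avg_top beta0 (ltW r0) (x1 0%N) (ltW C0) fC _ (x1 _) t1) _.
rewrite addrC; apply: lerD; last exact: (sP k).2.
have -> : `|t| `^ p = `|t| ^+ N * `|t| `^ beta.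
  have pE : N%:R + beta = p by rewrite addrC subrK.
  rewrite -(powR_mulrn _ (normr_ge0 t)) -powRD pE//.
  by rewrite gt_eqF// (lt_trans ltr01).
rewrite [leRHS]mulrCA ler_wpM2l ?exprn_ge0//.
rewrite -mulrA ler_wpM2l ?(ltW C0)// /sclass_modulus mulrDl mul1r lerD2r.
rewrite ler_wpM2l//.
(* It remains to see |t| <= |t|^beta, which holds since |t| <= 1 and beta <= 1. *)
have [t0|t0] := eqVneq `|t| 0; first by rewrite t0 powR_ge0.
rewrite -[leLHS]powRr1//; apply: ger_powR => //.
by rewrite t1 andbT lt_neqAle eq_sym t0/=.
Qed.

Lemma ell_of_not_vanishing (x : nat -> X) m : normalized_disjoint x ->
  (0 < m)%N -> (m <= N)%N -> ~~ odd m -> ~ derivs_vanish x m ->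
  (forall j, (0 < j < m)%N -> ~~ odd j -> derivs_vanish x j) ->
  contains_ell m%:R X.
Proof.
move=> xnd m0 mN om xm xv; have x1 := xnd.1.
have [y1 [sg' [d [s1 d0 Qf]]]] := not_derivs_vanish xm.
have eta0 : 0 < `|f y0| / 4 by rewrite divr_gt0// normr_gt0.
(* The sum over both base points yields one subsequence for both estimates: the upper one is made at
   [y0], the lower one at [y1]. *)
pose F n y := even_derivs f m (x n) (y0 + y) + even_derivs f m (x n) (y1 + y).
have Fu eps : 0 < eps -> exists2 d, 0 < d &
    forall n y z, `|y - z| <= d -> F n y <= F n z + eps.
  move=> eps0; have e20 : 0 < eps / 2 by rewrite divr_gt0.
  have [d' d'0 dP] := even_derivs_uniform beta0 (ltW r0) (x1 0%N) (ltW C0) fC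
    (leqW mN) x1 e20.
  exists d' => // n y z yz.
  have := dP n (y0 + y) (y0 + z); have := dP n (y1 + y) (y1 + z).
  have sh w : w + y - (w + z) = y - z by rewrite opprD addrACA subrr add0r.
  rewrite !sh /F.
  by move=> /(_ yz) h1 /(_ yz) h2; move: h1 h2; lra.
have Fv eps y : 0 < eps -> \forall n \near \oo, F n y <= eps.
  move=> eps0; have e20 : 0 < eps / 2 by rewrite divr_gt0.
  have h1 := even_derivs_vanish xv (y0 + y) e20.
  have h2 := even_derivs_vanish xv (y1 + y) e20.
  by apply: filterS2 h1 h2 => n h1 h2; rewrite /F; move: h1 h2; lra.
have [s s_incr sP] := small_subseq eta0 x1 Fu Fv Qf.
pose u := x \o s; have u1 n : `|u n| = 1 by exact: x1.
have und : normalized_disjoint u.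
  split=> // k l kl; apply: xnd.2; rewrite neq_ltn; have := kl; rewrite neq_ltn.
  by move=> /orP[/s_incr->//|/s_incr->]; rewrite orbT.
have rho0 : 0 < (m%:R : R) by rewrite ltr0n.
have rho1 : (1 <= (m%:R)%:E :> \bar R)%E by rewrite lee_fin ler1n.
have mf0 : 0 < (m`!%:R : R) by rewrite ltr0n fact_gt0.
have mf1 : 1 <= (m`!%:R : R) by rewrite ler1n fact_gt0.
have lead k z (t : R) : `|t| <= 1 ->
    `|even_avg f (u k) z t - t ^+ m / m`!%:R * iter m (dderive (u k)) f z| <=
    even_derivs f m (u k) z + `|t| ^+ m * (C * modulus `|t|).
  move=> t1.
  exact: (even_avg_leading beta0 (ltW r0) (x1 0%N) (ltW C0) fC).
have F0 n y : even_derivs f m (x n) (y0 + y) <= F n y.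
  by rewrite lerDl even_derivs_ge0.
have F1 n y : even_derivs f m (x n) (y1 + y) <= F n y.
  by rewrite lerDr even_derivs_ge0.
have up : upper_estimate m%:R
    ((r + r) / delta (C * B + C * (B + 1)) (m%:R)) u.
  have D0 : 0 < C * B + C * (B + 1).
    apply: ltr_wpDl; first by rewrite mulr_ge0// ltW.
    by rewrite mulr_gt0// ltr_wpDl.
  rewrite -sgf; apply: (upper_from_even_avg und rho0 D0 _ (@fv _)).
    by rewrite sgf normr_gt0.
  move=> k a t a1 t1; rewrite sgf; apply: gavg_le => //.
  set z := y0 + _; set T := t ^+ m / m`!%:R * iter m (dderive (u k)) f z.
  rewrite -[even_avg _ _ _ _](subrK T); apply: le_trans (ler_normD _ _) _.
  (* The term of order m is no longer small, but it is bounded by C B |t|^m and so fits an upper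
     m-estimate. *)
  have hT : `|T| <= `|t| ^+ m * (C * B).
    rewrite /T normrM normrM normrX; apply: ler_pM => //; rewrite ?mulr_ge0//.
      rewrite -[leRHS]mulr1 ler_wpM2l// normfV gtr0_norm// invf_le1//.
    exact: (sclass_iter_bounded (ltW r0) (x1 0%N) _ mN (leqnn _) (ltW C0) (u1 k) fC).
  have hM : modulus `|t| <= B + 1.
    apply: le_trans (sclass_modulus_le N beta0 (ltW r0) (normr_ge0 t) t1) _.
    by rewrite /sclass_modulus mulr1 powR1.
  have h1 := lead k z t t1; rewrite -/T in h1.
  have h2 : even_derivs f m (u k) z <= `|f y0| / 4 / 2 ^+ k.+1.
    by apply: le_trans (F0 _ _) _; exact: (sP k).2.
  have h3 : `|t| ^+ m * (C * modulus `|t|) <= `|t| ^+ m * (C * (B + 1)).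
    by rewrite ler_wpM2l// ler_wpM2l// ltW.
  rewrite powR_mulrn// mulrC mulrDr; move: hT h1 h2 h3; lra.
(* Within distance [tau] both the Taylor remainder factor and the variation of the derivative of
   order m are at most d / (4 m!). *)
have e0 : 0 < d / (4 * m`!%:R) / C by rewrite !divr_gt0// mulr_gt0.
have [tau' tau'0 tauP] := sclass_modulus_small N beta0 (ltW r0) e0.
pose tau := Num.min tau' 1.
have tau0 : 0 < tau by rewrite lt_min tau'0 ltr01.
have tau1 : tau <= 1 by rewrite ge_min lexx orbT.
have modC t : 0 <= t -> t <= tau -> C * modulus t <= d / (4 * m`!%:R).
  move=> t0; rewrite le_min => /andP[tt _].
  by rewrite mulrC -ler_pdivlMr// tauP.
(* The derivative of order m exceeds d at [y1], hence 3d / 4 nearby; its Taylor term is at least 3d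
   / (4 m!) |t|^m, and the remainder takes away d / (4 m!) |t|^m. This leaves the constant d / (2
   m!). *)
have low := @lower_from_even_avg _ _ u m%:R und (g sg') y1 (C * B)
  (d / (2 * m`!%:R)) (`|f y0| / 4) tau.
have {}low : forall n (a : nat -> R), `|\sum_(i < n) a i *: u i| <= tau ->
    power_sum m%:R n a <= (2 * (C * B) + `|f y0| / 4) / (d / (2 * m`!%:R)).
  apply: low; rewrite ?divr_gt0 ?mulr_gt0 ?tau0 ?(ltW eta0)//.
    move=> z; rewrite /g normrM s1 mul1r.
    exact: (sclass_bounded (ltW r0) (x1 0%N) _ (leqnn _) (ltW C0) fC).
  move=> k a t a1 az ttau; rewrite even_avg_scale.
  set z := \sum_(i < k) _ in az *.
  have t1 := le_trans ttau tau1.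
  have h1 := lead k (y1 + z) t t1.
  have h2 : even_derivs f m (u k) (y1 + z) <= `|f y0| / 4 / 2 ^+ k.+1.
    by apply: le_trans (F1 _ _) _; exact: (sP k).2.
  have h3 := modC _ (normr_ge0 t) ttau.
  have h4 : `|iter m (dderive (u k)) f (y1 + z) - iter m (dderive (u k)) f y1| <=
      d / (4 * m`!%:R).
    apply: le_trans (sclass_iter_equicontinuous (ltW r0) (x1 0%N) _ _ mN (leqnn _)
      (ltW C0) (u1 k) fC) _.
    by rewrite addrAC subrr add0r; exact: modC.
  have h5 : d < sg' * iter m (dderive (u k)) f y1 by exact: (sP k).1.
  set A := even_avg _ _ _ _ in h1 *.
  set D := iter m _ _ (y1 + z) in h1 h4; set D1 := iter m _ _ y1 in h4 h5.
  (* Evenness of m makes the leading term have the same sign for t and -t. *)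
  have tm : t ^+ m = `|t| ^+ m by rewrite -normrX ger0_norm// exprn_even_ge0.
  rewrite tm in h1; rewrite powR_mulrn//.
  have T0 : 0 <= `|t| ^+ m by rewrite exprn_ge0.
  move: (`|t| ^+ m) T0 h1 => T T0 h1.
  have {}h1 : sg' * (T / m`!%:R * D) - (even_derivs f m (u k) (y1 + z) +
      T * (C * modulus `|t|)) <= sg' * A.
    rewrite lerBlDl -lerBlDr -mulrBr; apply: le_trans (ler_norm _) _.
    by rewrite normrM s1 mul1r distrC.
  have {}h4 : sg' * D1 - sg' * D <= d / (4 * m`!%:R).
    rewrite -mulrBr; apply: le_trans (ler_norm _) _.
    by rewrite normrM s1 mul1r distrC.
  have h6 : d / (4 * m`!%:R) <= d / 4.
    by rewrite ler_wpM2l ?(ltW d0)// lef_pV2 ?posrE ?mulr_gt0// ler_peMr.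
  have h7 : T / m`!%:R * (3 / 4 * d) <= sg' * (T / m`!%:R * D).
    rewrite [leRHS]mulrCA ler_wpM2l ?divr_ge0 ?(ltW mf0)//; lra.
  have h8 : T * (C * modulus `|t|) <= T * (d / (4 * m`!%:R)).
    by rewrite ler_wpM2l.
  have h9 : T / m`!%:R * (3 / 4 * d) - T * (d / (4 * m`!%:R)) =
      d / (2 * m`!%:R) * T by field; rewrite gt_eqF.
  move: h1 h2 h7 h8 h9; lra.
exact: (contains_ell_embed rho1 und up (lower_estimate_scale und rho0 tau0 low)).
Qed.

End SmoothLattice.

(** * Conclusion: the least even order at which the derivatives fail to vanish *)

Theorem corollary3 (R : realType) (p : R) (X : banachLatticeType R) :
  1 < p ->
  (forall k : nat, (0 < k)%N -> (2 * k)%:R <= p ->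
     ~ contains_ell (2 * k)%:R X) ->
  UHp_smooth_space p X ->
  UDS p X.
Proof.
move=> p1 noell [f [[fN [C C0 fH]] [M [Mr fM]] [z zf]]].
(* Boundedness of the support gives a norm bound by every number above M, so r is taken strictly
   above M and positive. *)
pose r := Num.max M 0 + 1.
have r0 : 0 < r by rewrite ltr_wpDl// le_max lexx orbT.
have fv x : r < `|x| -> f x = 0.
  move=> rx; apply: contrapT => fx; suff : `|x| <= r by rewrite leNgt rx.
  apply: fM; last by apply: subset_closure; exact/eqP.
  by rewrite /r ltr_pwDr// le_max lexx.
have fC := nfrechet_smooth_class fN fH fv.
have [y0 fy0] : exists y0, f y0 != 0.
  apply: contrapT => /forallNP f0; move: zf; rewrite /supp.
  suff -> : [set x | f x != 0] = set0 by rewrite closure0.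
  by apply/seteqP; split=> // x /= /f0.
set D := C * (sclass_bound (p - (smooth_order p)%:R) r (smooth_order p) + 1).
exists ((r + r) / Num.min 1 (`|f y0| / (4 * D)) `^ p^-1).
  apply: divr_gt0; first exact: addr_gt0.
  apply: powR_gt0; rewrite lt_min ltr01/= divr_gt0 ?normr_gt0//.
  rewrite mulr_gt0// mulr_gt0// ltr_wpDl//.
  by apply: sclass_bound_ge0; exact: ltW.
move=> x xnd.
pose bad m := `[< [/\ (0 < m < (smooth_order p).+1)%N, ~~ odd m &
  ~ derivs_vanish f x m] >].
have [ex|nex] := pselect (exists m, bad m); last first.
  apply: upper_of_vanishing => // j jN oj; apply: contrapT => nv.
  by apply: nex; exists j; apply/asboolP.
have [m /asboolP[/andP[m0 mN] om nv] mmin] := ex_minnP ex.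
have /(_ _ _)[] := noell m./2.
- by case: m m0 om {mN nv mmin} => [|[]].
(* An order m <= N satisfies m < p, so l_m is among the excluded spaces. *)
- rewrite mul2n even_halfK//; apply: ltW; rewrite smooth_orderP//.
rewrite mul2n even_halfK//.
apply: (ell_of_not_vanishing p1 C0 r0 fy0 fC xnd m0) => //.
move=> j /andP[j0 jm] oj; apply: contrapT => nj.
suff : (m <= j)%N by rewrite leqNgt jm.
apply: mmin; apply/asboolP; split=> //.
by rewrite j0/= (ltn_trans jm).
Qed.
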